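(* Let $0\le t<1$, in which case $C_t\in\mathcal{L}(\ell^p)$ for all $1\le p\le\infty$. (i) For $p=1$ the operator $C_t\in\mathcal{L}(\ell^1)$ satisfies $\|C_t\|_{\ell^1\to\ell^1}=t^{-1}\log(1/(1-t))$ whenever $t\in(0,1)$, whereas $\|C_0\|_{\ell^1\to\ell^1}=1$. Moreover, $C_t$ is compact in $\ell^1$ with $\sigma_{pt}(C_t;\ell^1)=\Lambda$ and $\sigma(C_t;\ell^1)=\Lambda_0$, and $C_t$ is power bounded and uniformly mean ergodic in $\ell^1$ but not supercyclic. (ii) For $p=\infty$ the operator $C_t\in\mathcal{L}(\ell^\infty)$ satisfies $\|C_t\|_{\ell^\infty\to\ell^\infty}=1$ and is a compact operator with $\sigma_{pt}(C_t;\ell^\infty)=\Lambda$ and $\sigma(C_t;\ell^\infty)=\Lambda_0$. Moreover, $C_t$ is power bounded and uniformly mean ergodic in $\ell^\infty$ but not supercyclic. (iii) For $1<p<\infty$ each operator $C_t\in\mathcal{L}(\ell^p)$ satisfies $\|C_t\|_{\ell^p\to\ell^p}\le p/(p-1)$ and is compact with spectra $\sigma_{pt}(C_t;\ell^p)=\Lambda$ and $\sigma(C_t;\ell^p)=\Lambda_0$. Furthermore, $C_t$ is power bounded and uniformly mean ergodic but not supercyclic in $\ell^p$.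
   Context: Sequences are complex and indexed by $\mathbb{N}_0=\{0,1,2,\dots\}$. For $t\in[0,1]$ the generalized Cesàro operator is $C_tx=\big(\frac{t^nx_0+t^{n-1}x_1+\dots+x_n}{n+1}\big)_{n\in\mathbb{N}_0}$, with $t^0=1$ also for $t=0$. $\Lambda:=\{\frac1{n+1}:n\in\mathbb{N}_0\}$ and $\Lambda_0:=\Lambda\cup\{0\}$. $\mathcal{L}(X)$ is the space of bounded linear operators on a Banach space $X$; $\sigma(T;X)$ and $\sigma_{pt}(T;X)$ are the spectrum and point spectrum (set of eigenvalues) of $T\in\mathcal{L}(X)$. With $T_{[n]}:=\frac1n\sum_{m=1}^nT^m$, $T$ is uniformly mean ergodic if $(T_{[n]})_{n\geq 1}$ converges in operator norm; power bounded if $\sup_{n\ge1}\|T^n\|<\infty$; supercyclic if there is $x\in X$ with $\{\lambda T^nx:\lambda\in\mathbb{C},n\in\mathbb{N}_0\}$ dense in $X$. *)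

(* Defs.v *)
From HB Require Import structures.
From mathcomp Require Import all_boot all_order all_algebra.
From mathcomp Require Import complex.
From mathcomp Require finmap.
From mathcomp Require Import all_classical all_reals all_analysis.
From mathcomp Require Import ess_sup_inf.

Set Implicit Arguments.
Unset Strict Implicit.
Unset Printing Implicit Defensive.

Import Order.TTheory GRing.Theory Num.Theory.
Import numFieldNormedType.Exports.

Local Open Scope classical_set_scope.
Local Open Scope ring_scope.
Local Open Scope complex_scope.

(* Norms over the field R[i] take their values in R[i]; [normR] is the same
   norm, read in R. *)
Definition normR (R : realType) (V : normedZmodType R[i]) (x : V) : R :=
  complex.Re `|x|.

Section NormR.
Context (R : realType) (V : normedZmodType R[i]).
Implicit Types x y : V.

Lemma normRE x : (normR x)%:C = `|x|.
Proof. by rewrite /normR RRe_real ?normr_real. Qed.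

Lemma normR_ge0 x : 0 <= normR x.
Proof. by rewrite -lecR normRE normr_ge0. Qed.

Lemma normRD x y : normR (x + y) <= normR x + normR y.
Proof. by rewrite -lecR rmorphD/= !normRE ler_normD. Qed.

Lemma normR_eq0 x : normR x = 0 -> x = 0.
Proof. by move=> x0; apply/eqP; rewrite -normr_eq0 -normRE x0. Qed.

End NormR.

Lemma normRM (R : realType) (a b : R[i]) : normR (a * b) = normR a * normR b.
Proof.
apply: complexI; rewrite rmorphM/=.
by rewrite !normRE normrM.
Qed.

Section EllNorm.
Context (R : realType).
Implicit Types (p : \bar R) (x y : nat -> R[i]).
Local Open Scope ereal_scope.

(* For [p = +oo] this is the essential supremum, which for the counting measure
   is the supremum. *)
Definition ell_norm p x : \bar R :=
  'N[@counting nat R]_p [EFin \o (fun n => normR (x n))].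

End EllNorm.

Section EllNormTheory.
Context (R : realType).
Implicit Types (p : \bar R) (x y : nat -> R[i]).
Local Open Scope ereal_scope.

Lemma measurable_fun_nat d (T : sigmaRingType d) (D : set nat) (f : nat -> T) :
  measurable_fun D f.
Proof. by []. Qed.

Lemma le_Lnorm_nat p (f g : nat -> R) : 1 <= p ->
  (forall n, (0 <= f n <= g n)%R) ->
  'N[@counting nat R]_p [EFin \o f] <= 'N[@counting nat R]_p [EFin \o g].
Proof.
move=> p1 fg; rewrite unlock; case: p p1 => [r|_|//].
- rewrite lee_fin => r1.
  have r0 : (0 <= r)%R by rewrite (le_trans ler01).
  apply: gt0_ler_poweR; rewrite ?invr_ge0 ?in_itv/= ?leey ?andbT ?integral_ge0//.
  apply: ge0_le_integral => // n _ /=.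
  by have /andP[f0 fgn] := fg n;
     rewrite lee_fin ge0_ler_powR ?nnegrE// !ger0_norm// (le_trans f0).
- case: ifPn => // _; apply: le_ess_sup; apply: nearW => n /=.
  have /andP[f0 fgn] := fg n.
  by rewrite lee_fin !ger0_norm// (le_trans f0).
Qed.

Lemma ell_norm_ge0 p x : 0 <= ell_norm p x.
Proof. exact: Lnorm_ge0. Qed.

Lemma ell_normD p x y : 1 <= p ->
  ell_norm p (x + y)%R <= ell_norm p x + ell_norm p y.
Proof.
move=> p1; apply: (@le_trans _ _ ('N[@counting nat R]_p
    [EFin \o ((fun n => normR (x n)) \+ (fun n => normR (y n)))%R])).
  by apply: le_Lnorm_nat => // n; rewrite normR_ge0/= normRD.
exact: eminkowski.
Qed.

Lemma ell_norm0 p : 1 <= p -> ell_norm p 0%R = 0.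
Proof.
move=> p1; rewrite /ell_norm -(@Lnorm0 _ _ _ (@counting nat R) p).
  by congr Lnorm; apply/funext => n /=; rewrite /normR normr0.
by rewrite gt_eqF// (lt_le_trans _ p1).
Qed.

Lemma ell_norm_eq0 p x : 1 <= p -> ell_norm p x = 0 -> x = 0%R.
Proof.
move=> p1 /Lnorm_eq0_eq0 => /(_ (@measurable_fun_nat _ _ _ _)).
move=> /(_ (lt_le_trans lte01 p1)) [A [_ A0 subA]].
have A_set0 : A = set0.
  move: A0; rewrite /= /counting; case: asboolP => // finA /eqP.
  by rewrite eqe pnatr_eq0 finmap.cardfs_eq0 => /eqP/fset_set_set0 ->.
apply/funext => n; apply: normR_eq0; apply: contrapT => xn0.
suff : A n by rewrite A_set0.
by apply: subA => /= /(_ Logic.I) -[].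
Qed.

Lemma ell_normZ p (a : R[i]) x : 1 <= p -> ell_norm p x < +oo ->
  ell_norm p (a *: x) = (normR a)%:E * ell_norm p x.
Proof.
move=> p1 xoo; pose f n := normR (x n).
have fL : f \in Lfun (@counting nat R) p.
  by rewrite inE; apply/andP; split; rewrite inE.
have := LnormZ (Lfun_Sub p1 fL) (normR a).
rewrite ger0_norm ?normR_ge0// => <-; congr Lnorm.
by apply/funext => n /=; rewrite normRM.
Qed.

End EllNormTheory.


Definition ell_mem (R : realType) (p : \bar R) : {pred nat -> R[i]} :=
  fun x => (ell_norm p x < +oo)%E.

(* The proof [p1] is not used in the carrier: it is recorded so that the
   normed space structure can be attached to [ell p1]. *)
Definition ell (R : realType) (p : \bar R) (p1 : (1 <= p)%E) : Type :=
  {x : nat -> R[i] | x \in ell_mem p}.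

Section EllSpace.
Context (R : realType) (p : \bar R) (p1 : (1 <= p)%E).

Local Notation ell := (ell p1).

HB.instance Definition _ := [isSub of ell for sval].
HB.instance Definition _ := [Choice of ell by <:].

Lemma ell_submod_closed : submod_closed (@ell_mem R p).
Proof.
split; first by rewrite unfold_in /ell_mem ell_norm0.
move=> a x y; rewrite !unfold_in /ell_mem => xp yp.
apply: (le_lt_trans (ell_normD _ _ p1)).
by rewrite lte_add_pinfty// ell_normZ// lte_mul_pinfty ?lee_fin ?normR_ge0.
Qed.

HB.instance Definition _ := GRing.isSubmodClosed.Build _ _ (@ell_mem R p)
  ell_submod_closed.

HB.instance Definition _ := [SubChoice_isSubLmodule of ell by <:].

Definition ell_nrm (x : ell) : R[i] := (fine (ell_norm p (val x)))%:C.

Lemma ell_norm_fin (x : ell) : ell_norm p (val x) \is a fin_num.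
Proof. by rewrite ge0_fin_numE ?ell_norm_ge0//; exact: valP x. Qed.

Lemma ell_nrmD (x y : ell) : ell_nrm (x + y) <= ell_nrm x + ell_nrm y.
Proof.
rewrite /ell_nrm -rmorphD/= lecR -fineD ?ell_norm_fin//.
rewrite fine_le ?ell_normD// ?fin_numD ?ell_norm_fin//.
exact: ell_norm_fin (x + y).
Qed.

Lemma ell_nrmZ (a : R[i]) (x : ell) : ell_nrm (a *: x) = `|a| * ell_nrm x.
Proof.
rewrite /ell_nrm ell_normZ//; last exact: valP x.
by rewrite fineM ?ell_norm_fin// rmorphM/= normRE.
Qed.

Lemma ell_nrm_eq0 (x : ell) : ell_nrm x = 0 -> x = 0.
Proof.
move=> /complexI x0; apply/val_inj/(ell_norm_eq0 p1).
by rewrite -(fineK (ell_norm_fin x)) x0.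
Qed.

HB.instance Definition _ := Lmodule_isNormed.Build R[i] ell
  ell_nrmD ell_nrmZ ell_nrm_eq0.

End EllSpace.

Definition ell_seq (R : realType) (p : \bar R) (p1 : (1 <= p)%E) (x : ell p1) :
  nat -> R[i] := val x.
Coercion ell_seq : ell >-> Funclass.

Lemma normR_ell (R : realType) (p : \bar R) (p1 : (1 <= p)%E) (x : ell p1) :
  (normR x)%:E = ell_norm p x.
Proof. by rewrite /normR/= fineK ?ell_norm_fin. Qed.

Section Operators.
Context (R : realType) (V : normedModType R[i]).
Implicit Types T S P : V -> V.

(* [+oo] when [T] is unbounded on the unit ball. *)
Definition op_norm T : \bar R :=
  ereal_sup [set (normR (T x))%:E | x in [set x : V | normR x <= 1]].

Definition bounded_operator T : Prop := linear T /\ (op_norm T < +oo)%E.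

Definition point_spectrum T : set R[i] :=
  [set l | exists2 x : V, x != 0 & T x = l *: x].

Definition resolvent_set T : set R[i] :=
  [set l | exists S, [/\ bounded_operator S,
     cancel (fun x => l *: x - T x) S & cancel S (fun x => l *: x - T x)]].

Definition spectrum T : set R[i] := ~` resolvent_set T.

Definition compact_operator T : Prop :=
  bounded_operator T /\ precompact (T @` [set x : V | normR x <= 1]).

Definition power_bounded T : Prop :=
  (ereal_sup [set op_norm (iter n T) | n in [set n | (1 <= n)%N]] < +oo)%E.

(* The value at [n = 0] is irrelevant. *)
Definition ergodic_mean T (n : nat) (x : V) : V :=
  n%:R^-1 *: \sum_(1 <= m < n.+1) iter m T x.

Definition uniformly_mean_ergodic T : Prop :=
  exists2 P, bounded_operator P &
    op_norm (fun x => ergodic_mean T n x - P x) @[n --> \oo] --> 0%E.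

Definition supercyclic T : Prop :=
  exists x : V, dense [set y : V | exists l : R[i], exists n : nat, y = l *: iter n T x].

End Operators.

(* [t ^+ 0 = 1] also for [t = 0]. *)
Definition gen_cesaro (R : realType) (t : R) (x : nat -> R[i]) (n : nat) : R[i] :=
  (\sum_(i < n.+1) (t ^+ (n - i))%:C * x i) / n.+1%:R.

Definition Lambda (R : realType) : set R[i] :=
  [set (n.+1%:R)^-1 | n in [set: nat]].
Arguments Lambda : clear implicits.

Definition Lambda0 (R : realType) : set R[i] := Lambda R `|` [set 0].
Arguments Lambda0 : clear implicits.

(* Main.v *)
From HB Require Import structures.
Require Import Defs.
From mathcomp Require Import all_boot all_order all_algebra.
From mathcomp Require Import complex.
From mathcomp Require Import all_classical all_reals all_analysis.
From mathcomp Require Import ring lra.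
From mathcomp Require Import ess_sup_inf.

(** For [t < 1] the sequence [z = C_t x] is determined by
    [(n + 1) z_n = t n z_(n-1) + x_n], and most claims are read off this first
    order recurrence, for all [p] at once. Taking moduli and solving
    [v <= t (shift v) + |x|] shows that [(n + 1) z_n] is bounded in [l^p] by
    [|x| / (1 - t)]; since the weight tends to infinity, the image of the unit ball
    is relatively compact. Eigenvectors and resolvents solve similar recurrences,
    with coefficients whose moduli tend to [t]. On the invariant subspace
    [x_0 = 0] each coordinate and each sufficiently far tail of [C_t^m x] decays
    like [(3/4)^m], so that [C_t^m] converges in norm to the rank one projection
    [x |-> x_0 (t^n)_n]. Two eigenvectors of the adjoint with distinct eigenvalues
    prevent supercyclicity. *)

Set Implicit Arguments.
Unset Strict Implicit.
Unset Printing Implicit Defensive.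

Import Order.TTheory GRing.Theory Num.Theory.
Import numFieldNormedType.Exports.

Local Open Scope classical_set_scope.
Local Open Scope ring_scope.

(** * Norms of nonnegative sequences *)

(** Estimates are made on nonnegative real sequences, in the form [seq_norm p f <= M%:E] with [M]
    real. A few lemmas (coordinate, truncation, shift, unit vector, scaling) distinguish [p = +oo]
    from finite [p]; up to the operator norms, the rest is uniform in [p]. Two obstacles shape the
    estimates. A solution of a recurrence is not known beforehand to lie in [l^p], so its norm
    cannot be moved from one side of an inequality to the other; this is done for truncations, with
    a bound independent of their length. And the coordinate estimates for [C_t^m] come with
    constants that are not controlled as the coordinate grows, so they cannot be summed: finitely
    many are used, and the remaining tail is treated as a single vector. The rate [3/4] has this
    origin: on [x_0 = 0] the diagonal entries [1/(n+1)] of the triangular matrix are at most [1/2],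
    and the gap between [1/2] and [3/4] absorbs what a coordinate receives from the earlier ones. *)

Section LittleLp.
Context (R : realType).
Implicit Types (p : \bar R) (f g : nat -> R) (M r : R).

Definition seq_norm p f : \bar R := 'N[@counting nat R]_p [EFin \o f]%E.

Lemma seq_norm_ge0 p f : (0 <= seq_norm p f)%E.
Proof. exact: Lnorm_ge0. Qed.

Lemma le_seq_norm p f g : (1 <= p)%E -> (forall n, 0 <= f n <= g n) ->
  (seq_norm p f <= seq_norm p g)%E.
Proof. exact: le_Lnorm_nat. Qed.

Lemma seq_normD p f g : (1 <= p)%E ->
  (seq_norm p (fun n => (f n + g n)%R) <= seq_norm p f + seq_norm p g)%E.
Proof. exact: eminkowski. Qed.

Lemma seq_normP r f M : 0 < r -> 0 <= M -> (forall n, 0 <= f n) ->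
  (seq_norm r%:E f <= M%:E)%E <->
  (forall N, \sum_(n < N) f n `^ r <= M `^ r).
Proof.
move=> r0 M0 f0.
have fE : (seq_norm r%:E f `^ r = \sum_(k <oo) (f k `^ r)%:E)%E.
  rewrite powR_Lnorm ?gt_eqF//= ge0_integral_count => [|k]; last first.
    by rewrite lee_fin powR_ge0.
  by apply: eq_eseriesr => k _ /=; rewrite ger0_norm.
have f0' k : (0 <= k)%N -> true -> (0 <= (f k `^ r)%:E)%E.
  by rewrite lee_fin powR_ge0.
have sumE N : (\sum_(n < N) f n `^ r)%:E = (\sum_(0 <= n < N) (f n `^ r)%:E)%E.
  by rewrite big_mkord sumEFin.
have i0 (z : \bar R) : (0 <= z)%E -> z \in `[0%E, +oo%E].
  by move=> z0; rewrite in_itv/= z0 leey.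
split=> [fM N|fM].
  rewrite -lee_fin sumE.
  apply: (le_trans (nneseries_lim_ge N f0')).
  rewrite -fE -poweR_EFin gt0_ler_poweR ?i0 ?seq_norm_ge0 ?lee_fin// ltW//.
have : (seq_norm r%:E f `^ r <= (M `^ r)%:E)%E.
  rewrite fE; apply: lime_le; first exact: is_cvg_nneseries.
  by apply: nearW => N; rewrite -sumE lee_fin.
move=> /gt0_ler_poweR-/(_ r^-1).
rewrite invr_ge0 ltW// => /(_ isT); rewrite !i0 ?poweR_ge0//; last first.
  by rewrite lee_fin powR_ge0.
move=> /(_ isT isT).
rewrite -poweRrM divff ?gt_eqF// poweRe1 ?seq_norm_ge0//.
by rewrite poweR_EFin -powRrM divff ?gt_eqF// powRr1.
Qed.

Lemma seq_norm_inftyP f (y : \bar R) : (forall n, 0 <= f n) ->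
  (seq_norm +oo%E f <= y)%E <-> (forall n, ((f n)%:E <= y)%E).
Proof.
move=> f0; rewrite /seq_norm unlock /= /counting; case: asboolP => [fin|_].
  by have := infinite_nat.
rewrite ltry; split=> [/ess_supP [A [_ A0 sub]] n|fM]; last first.
  by apply/ess_supP; apply: aeW => n /=; rewrite ger0_norm.
(* The counting measure has no null set but the empty one, so an essential bound holds at every
   index. *)
have A_set0 : A = set0.
  move: A0; rewrite /= /counting; case: asboolP => // finA /eqP.
  by rewrite eqe pnatr_eq0 finmap.cardfs_eq0 => /eqP/fset_set_set0 ->.
apply: contrapT => fn; suff : A n by rewrite A_set0.
by apply: sub => /=; rewrite ger0_norm.
Qed.

Lemma seq_norm_EFin_ge0 p f M : (seq_norm p f <= M%:E)%E -> 0 <= M.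
Proof. by move=> /(le_trans (seq_norm_ge0 p f)); rewrite lee_fin. Qed.

Lemma seq_norm_coord p f M n : (1 <= p)%E -> (forall n, 0 <= f n) ->
  (seq_norm p f <= M%:E)%E -> f n <= M.
Proof.
move=> p1 f0 fM; have M0 := seq_norm_EFin_ge0 fM.
case: p p1 fM => [r|_|//]; last by move=> /seq_norm_inftyP-/(_ f0 n); rewrite lee_fin.
rewrite lee_fin => r1; have r0 : 0 < r by rewrite (lt_le_trans _ r1).
move=> /(seq_normP r0 M0 f0) /(_ n.+1).
rewrite big_ord_recr/= => fM; rewrite leNgt; apply/negP => /(gt0_ltr_powR r0).
rewrite !nnegrE M0 f0 => /(_ isT isT); rewrite ltNge => /negP; apply.
by apply: le_trans fM; rewrite lerDr sumr_ge0// => i _; rewrite powR_ge0.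
Qed.

Definition seq_trunc N f n := if (n < N)%N then f n else 0.

(** The passage from finite sections to the whole sequence, for use when [f] is not yet known to
    have finite norm. *)
Lemma seq_norm_trunc_sup p f M : (1 <= p)%E -> (forall n, 0 <= f n) ->
  (forall N, (seq_norm p (seq_trunc N f) <= M%:E)%E) -> (seq_norm p f <= M%:E)%E.
Proof.
move=> p1 f0 fM; have M0 := seq_norm_EFin_ge0 (fM 0%N).
have t0 N n : 0 <= seq_trunc N f n by rewrite /seq_trunc; case: ifP.
case: p p1 fM => [r|_ fM|//].
  rewrite lee_fin => r1; have r0 : 0 < r by rewrite (lt_le_trans _ r1).
  move=> fM; apply/(seq_normP r0 M0 f0) => N.
  have /(seq_normP r0 M0 (t0 N)) /(_ N) := fM N.
  by apply: le_trans; apply: ler_sum => i _; rewrite /seq_trunc ltn_ord.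
apply/seq_norm_inftyP => // n.
by have /(seq_norm_inftyP _ (t0 n.+1)) /(_ n) := fM n.+1; rewrite /seq_trunc ltnSn.
Qed.

(** The leading [0] lets a recurrence be stated for all [n] at once; a general [V] serves both
    complex sequences and their moduli. *)
Definition seq_shift (V : nmodType) (u : nat -> V) n := if n is m.+1 then u m else 0.

Lemma seq_norm_shift p f M : (1 <= p)%E -> (forall n, 0 <= f n) ->
  (seq_norm p f <= M%:E)%E -> (seq_norm p (seq_shift f) <= M%:E)%E.
Proof.
move=> p1 f0 fM; have M0 := seq_norm_EFin_ge0 fM.
have s0 n : 0 <= seq_shift f n by case: n => /=.
case: p p1 fM => [r|_ /(seq_norm_inftyP _ f0) fM|//].
  rewrite lee_fin => r1; have r0 : 0 < r by rewrite (lt_le_trans _ r1).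
  move=> /(seq_normP r0 M0 f0) fM; apply/(seq_normP r0 M0 s0) => -[|N].
    by rewrite big_ord0 powR_ge0.
  by rewrite big_ord_recl/= powR0 ?gt_eqF// add0r; exact: fM.
apply/seq_norm_inftyP => // -[|n] /=; first by rewrite lee_fin.
exact: fM.
Qed.

Lemma seq_norm_delta p k : (1 <= p)%E ->
  (seq_norm p (fun n => (n == k)%:R) <= 1)%E.
Proof.
case: p => [r|_|//]; last first.
  by apply/seq_norm_inftyP => // n; rewrite lee_fin; case: eqP.
rewrite lee_fin => r1; have r0 : 0 < r by rewrite (lt_le_trans _ r1).
apply/(seq_normP r0) => // N; rewrite powR1.
case: (ltnP k N) => [kN|Nk].
  rewrite (bigD1 (Ordinal kN))//= eqxx powR1 big1 ?addr0// => i.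
  by rewrite -val_eqE/= => /negbTE ->; rewrite powR0 ?gt_eqF.
rewrite big1 // => i _; rewrite ltn_eqF ?powR0 ?gt_eqF//.
exact: leq_trans (ltn_ord i) Nk.
Qed.

Lemma seq_normZ p f a M : (1 <= p)%E -> (forall n, 0 <= f n) -> 0 <= a ->
  (seq_norm p f <= M%:E)%E -> (seq_norm p (fun n => a * f n)%R <= (a * M)%:E)%E.
Proof.
move=> p1 f0 a0 fM; have M0 := seq_norm_EFin_ge0 fM.
have s0 n : 0 <= a * f n by rewrite mulr_ge0.
have aM0 : 0 <= a * M by rewrite mulr_ge0.
case: p p1 fM => [r|_ /(seq_norm_inftyP _ f0) fM|//].
  rewrite lee_fin => r1; have r0 : 0 < r by rewrite (lt_le_trans _ r1).
  move=> /(seq_normP r0 M0 f0) fM; apply/(seq_normP r0 aM0 s0) => N.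
  rewrite powRM//; under eq_bigr do rewrite powRM//.
  by rewrite -mulr_sumr ler_wpM2l ?powR_ge0.
apply/seq_norm_inftyP => // n.
by rewrite lee_fin ler_wpM2l// -lee_fin fM.
Qed.

Lemma seq_norm_leD p f g h M K : (1 <= p)%E ->
  (forall n, 0 <= h n <= f n + g n) ->
  (seq_norm p f <= M%:E)%E -> (seq_norm p g <= K%:E)%E ->
  (seq_norm p h <= (M + K)%:E)%E.
Proof.
move=> p1 hfg fM gK; apply: (le_trans (le_seq_norm p1 hfg)).
by apply: (le_trans (seq_normD _ _ p1)); rewrite EFinD leeD.
Qed.

Lemma seq_norm_le p f h M : (1 <= p)%E -> (forall n, 0 <= h n <= f n) ->
  (seq_norm p f <= M%:E)%E -> (seq_norm p h <= M%:E)%E.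
Proof. by move=> p1 hf; apply: le_trans; apply: le_seq_norm. Qed.

End LittleLp.

(** * First order recurrences *)

Section Domination.
Context (R : realType).
Implicit Types (p : \bar R) (f g z y : nat -> R) (M r : R).

Lemma seq_trunc_ge0 N f : (forall n, 0 <= f n) -> forall n, 0 <= seq_trunc N f n.
Proof. by move=> f0 n; rewrite /seq_trunc; case: ifP. Qed.

Lemma seq_shift_ge0 f : (forall n, 0 <= f n) -> forall n, 0 <= seq_shift f n.
Proof. by move=> f0 [|n] /=. Qed.

Lemma seq_norm_trunc_le p N f : (1 <= p)%E -> (forall n, 0 <= f n) ->
  (seq_norm p (seq_trunc N f) <= (\sum_(i < N) f i)%:E)%E.
Proof.
move=> p1 f0; elim: N => [|N IH].
  rewrite big_ord0 -(mul0r (1 : R)).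
  apply: (@seq_norm_le _ _ (fun n => 0 * (n == 0%N)%:R)) => //.
    by move=> n; rewrite mul0r /seq_trunc ltn0 lexx.
  by apply: seq_normZ => //; exact: seq_norm_delta.
rewrite big_ord_recr/= -[X in _ + X]mulr1.
apply: seq_norm_leD IH (seq_normZ p1 _ (f0 N) (seq_norm_delta N p1)) => //.
move=> n; rewrite seq_trunc_ge0//= /seq_trunc ltnS leq_eqVlt.
by case: (ltngtP n N) => [nN|nN|->] /=; rewrite ?mulr0 ?addr0 ?add0r ?mulr1.
Qed.

(** The shift does not increase norms, so a finite norm [a] of [z] would satisfy [a <= r a + M].
    Finiteness is secured by truncating [z], which preserves the inequality since the shift only
    looks back. *)
Lemma seq_norm_geometric p r M z y : (1 <= p)%E -> 0 <= r -> r < 1 ->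
  (forall n, 0 <= z n) -> (forall n, 0 <= y n) ->
  (forall n, z n <= r * seq_shift z n + y n) ->
  (seq_norm p y <= M%:E)%E -> (seq_norm p z <= (M / (1 - r))%:E)%E.
Proof.
move=> p1 r0 r1 z0 y0 zr yM; apply: seq_norm_trunc_sup => // N.
have t0 := seq_trunc_ge0 N z0.
have := seq_norm_trunc_le N p1 z0; move: (\sum_(i < N) _) => S tS.
have /fineK : seq_norm p (seq_trunc N z) \is a fin_num.
  by rewrite ge0_fin_numE ?seq_norm_ge0// (le_lt_trans tS) ?ltry.
move: (fine _) => a /esym aE; rewrite aE.
have le_a : (seq_norm p (seq_trunc N z) <= a%:E)%E by rewrite aE.
have : (seq_norm p (seq_trunc N z) <= (r * a + M)%:E)%E.
  apply: seq_norm_leD _ (seq_normZ p1 _ r0 (seq_norm_shift p1 t0 le_a)) yM => //.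
    move=> n; rewrite t0/= {1}/seq_trunc; case: ifPn => nN.
      apply: (le_trans (zr n)); rewrite lerD2r ler_wpM2l//.
      by case: n nN => //= n nN; rewrite /seq_trunc (ltnW nN).
    by rewrite addr_ge0// mulr_ge0// seq_shift_ge0.
  exact: seq_shift_ge0.
rewrite aE !lee_fin => aM; rewrite ler_pdivlMr ?subr_gt0//; nra.
Qed.

(** The convolution of [y] with the powers of [r], which solves the recurrence of constant ratio [r]
    with equality. *)
Fixpoint geom_sum r y n :=
  if n is m.+1 then r * geom_sum r y m + y n else y 0%N.

Lemma geom_sum_ge0 r y n : 0 <= r -> (forall n, 0 <= y n) -> 0 <= geom_sum r y n.
Proof. by move=> r0 y0; elim: n => //= n IH; rewrite addr_ge0 ?mulr_ge0. Qed.

(** Only finitely many ratios [A n] may exceed [r], and each of them costs a finite factor. As [K]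
    is chosen before [z] and [y], it later yields operator bounds. *)
Lemma recurrence_geom_sum (A : nat -> R) B r N0 : 0 <= B -> 0 < r ->
  (forall n, 0 <= A n) -> (forall n, (N0 <= n)%N -> A n <= r) ->
  exists2 K, 0 <= K & forall z y, (forall n, 0 <= z n) -> (forall n, 0 <= y n) ->
    (forall n, z n <= A n * seq_shift z n + B * y n) ->
    forall n, z n <= K * geom_sum r y n.
Proof.
move=> B0 r0 A0 Ar.
have [K K0 HK] : exists2 K, B <= K & forall z y, (forall n, 0 <= z n) ->
    (forall n, 0 <= y n) -> (forall n, z n <= A n * seq_shift z n + B * y n) ->
    forall n, (n <= N0)%N -> z n <= K * geom_sum r y n.
  elim: {Ar} N0 => [|N [K BK IH]].
    exists B => // z y z0 y0 zy n; rewrite leqn0 => /eqP ->.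
    by have := zy 0%N; rewrite /= mulr0 add0r.
  have Ar0 : 0 <= A N.+1 / r by rewrite divr_ge0// ltW.
  have K0 : 0 <= K by exact: le_trans BK.
  (* The second summand pays for [A N.+1 * (K * w)], rewritten as a multiple of [r * w]; the first
     keeps the earlier indices and, by the invariant [B <= K], pays for [B * y N.+1]. *)
  exists (K + A N.+1 / r * K).
    by rewrite (le_trans BK)// lerDl mulr_ge0.
  move=> z y z0 y0 zy n; rewrite leq_eqVlt => /orP[/eqP ->|].
    have := zy N.+1; have := IH z y z0 y0 zy N (leqnn N) => /=.
    have := geom_sum_ge0 N (ltW r0) y0; have := y0 N.+1.
    move: (geom_sum r y N) => w yN w0 zw /le_trans; apply.
    have -> : (K + A N.+1 / r * K) * (r * w + y N.+1) =
        A N.+1 * (K * w) + B * y N.+1 +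
        (K * r * w + A N.+1 / r * K * y N.+1 + (K - B) * y N.+1).
      by field; rewrite gt_eqF.
    rewrite -[leLHS]addr0 lerD//; first by rewrite lerD2r ler_wpM2l.
    by rewrite !addr_ge0 ?(mulr_ge0, subr_ge0, invr_ge0)// ltW.
  rewrite ltnS => nN; apply: le_trans (IH _ _ z0 y0 zy _ nN) _.
  by apply: ler_wpM2r; [exact: geom_sum_ge0 (ltW r0) y0|rewrite lerDl mulr_ge0].
exists K; first exact: le_trans K0.
move=> z y z0 y0 zy; elim=> [|n IH]; first exact: HK.
have [nN|Nn] := leqP n.+1 N0; first exact: HK.
apply: (le_trans (zy _)) => /=.
rewrite mulrDr lerD ?ler_wpM2r// mulrCA.
apply: (le_trans (ler_wpM2l (A0 _) IH)).
rewrite ler_wpM2r ?Ar ?mulr_ge0 ?geom_sum_ge0// ?(ltW r0)//; last exact: ltnW.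
exact: le_trans K0.
Qed.

Lemma recurrence_seq_norm (A : nat -> R) B r N0 : 0 <= B -> 0 < r -> r < 1 ->
  (forall n, 0 <= A n) -> (forall n, (N0 <= n)%N -> A n <= r) ->
  exists2 K, 0 <= K & forall p z y M, (1 <= p)%E ->
    (forall n, 0 <= z n) -> (forall n, 0 <= y n) ->
    (forall n, z n <= A n * seq_shift z n + B * y n) ->
    (seq_norm p y <= M%:E)%E -> (seq_norm p z <= (K * M)%:E)%E.
Proof.
move=> B0 r0 r1 A0 /(recurrence_geom_sum B0 r0 A0) [K K0 HK].
exists (K / (1 - r)).
  by rewrite divr_ge0// subr_ge0 ltW.
move=> p z y M p1 z0 y0 zy yM.
apply: (@seq_norm_le _ _ (fun n => K * geom_sum r y n)) => //.
  by move=> n; rewrite z0 HK.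
have g0 n : 0 <= geom_sum r y n by rewrite geom_sum_ge0// ltW.
rewrite mulrAC -mulrA; apply: seq_normZ => //.
apply: seq_norm_geometric (ltW r0) r1 g0 y0 _ yM => //.
by move=> [|n] //=; rewrite mulr0 add0r.
Qed.

End Domination.

(** * The Cesàro recurrence: weighted bounds and decay of iterates *)

Section CesaroRecurrence.
Context (R : realType) (t : R) (t0 : 0 <= t) (t1 : t < 1).
Implicit Types (p : \bar R) (f g z y : nat -> R) (M r : R).

(* Satisfied by the moduli of the entries of [z = C_t x] and [x = y], since
   [(n + 1) z_n = t n z_(n-1) + x_n]. *)
Definition cesaro_le z y := forall n, n.+1%:R * z n <= t * (n%:R * seq_shift z n) + y n.

(** Since [n z_(n-1)] is the shift of [(n + 1) z_n], the weighted sequence obeys a recurrence of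
    constant ratio [t]. *)
Lemma cesaro_le_weighted p M z y : (1 <= p)%E ->
  (forall n, 0 <= z n) -> (forall n, 0 <= y n) -> cesaro_le z y ->
  (seq_norm p y <= M%:E)%E ->
  (seq_norm p (fun n => n.+1%:R * z n)%R <= (M / (1 - t))%:E)%E.
Proof.
move=> p1 z0 y0 zy yM; apply: seq_norm_geometric t0 t1 _ y0 _ yM => //.
  by move=> n; rewrite mulr_ge0.
by move=> n; apply: le_trans (zy n) _; case: n => [|n] /=; rewrite ?mul0r.
Qed.

Lemma cesaro_le_norm p M z y : (1 <= p)%E ->
  (forall n, 0 <= z n) -> (forall n, 0 <= y n) -> cesaro_le z y ->
  (seq_norm p y <= M%:E)%E -> (seq_norm p z <= (M / (1 - t))%:E)%E.
Proof.
move=> p1 z0 y0 zy yM.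
apply: (@seq_norm_le _ _ (fun n => n.+1%:R * z n)) => //; last first.
  exact: cesaro_le_weighted yM.
by move=> n; rewrite z0/= ler_peMl// ler1n.
Qed.

(** Here [a m] stands for the moduli of [C_t^m x], where [x_0 = 0] and the entries of [x] are
    bounded by [M]. *)
Definition decay_bound (a : nat -> nat -> R) K n := forall M, 0 <= M ->
  (forall m n, 0 <= a m n) -> (forall n, a 0%N n <= M) ->
  (forall m, a m 0%N = 0) -> (forall m, cesaro_le (a m.+1) (a m)) ->
  forall m, a m n <= K * (3 / 4) ^+ m * M.

(** Coordinate [n + 1] is multiplied by [1/(n + 2) <= 1/2] at each iteration and fed by coordinate
    [n], which already decays at rate [3/4]. Hence an induction on [n], and for each [n] one on
    [m]. *)
Lemma cesaro_decay_coord n : exists K, 0 <= K /\ forall a, decay_bound a K n.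
Proof.
elim: n => [|n [K [K0 HK]]].
  by exists 0; split=> // a M M0 a0 aM a00 aS m; rewrite a00 !mul0r.
(* The summand [1] covers [m = 0]. With [c = 3 K + 1], the induction on [m] needs
   [3/4 (N + 1) K + c <= 3/4 (N + 2) c], which holds for all [N >= 0]. *)
exists (3 * K + 1); split; first by rewrite addr_ge0// mulr_ge0.
move=> a M M0 a0 aM a00 aS; elim=> [|m IH].
  rewrite expr0 mulr1; apply: (le_trans (aM _)).
  by rewrite mulrDl mul1r lerDr !mulr_ge0.
have := aS m n.+1 => /=; have := HK a M M0 a0 aM a00 aS m.+1; move: IH.
have : 0 <= (3 / 4 : R) ^+ m * M by rewrite mulr_ge0// exprn_ge0.
rewrite !exprS; move: (_ ^+ m) => x e0.
have E1 c : c * (3 / 4 * x) * M = c * (3 / 4 * (x * M)) by ring.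
have E2 c : c * x * M = c * (x * M) by ring.
rewrite !E1 !E2; move: (x * M) e0 => e e0 am an {E1 E2}.
rewrite -[n.+2%:R]natr1 -[n.+1%:R]natr1.
move: (a0 m.+1 n.+1) (a0 m.+1 n) (a0 m n.+1) am an.
move: (a m.+1 n.+1) (a m.+1 n) (a m n.+1) (ler0n R n) => u v w.
move: (n%:R) => N n0 u0 v0 w0 wK vK h.
have tv : t * ((N + 1) * v) <= (N + 1) * v.
  by apply: ler_piMl (ltW t1); rewrite mulr_ge0// addr_ge0.
suff : (N + 1 + 1) * u <= (N + 1 + 1) * ((3 * K + 1) * (3 / 4 * e)).
  by rewrite ler_pM2l// !ltr_wpDl// addr_ge0.
have : (N + 1) * v <= (N + 1) * (K * (3 / 4 * e)) by rewrite ler_wpM2l// addr_ge0.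
have : 0 <= K * e by rewrite mulr_ge0.
have : 0 <= N * (K * e) by rewrite !mulr_ge0.
have : 0 <= N * e by rewrite mulr_ge0.
nra.
Qed.

(** Beyond an index [N] the recurrence has ratio [t] and forcing at most [1/(N+2)] times the
    previous iterate. Up to what enters from coordinate [N], one iteration thus multiplies the norm
    of the tail by at most [1/((N+2)(1-t))], which is at most [1/2] for [N] large. *)
Lemma cesaro_decay : exists2 K, 0 <= K &
  forall p (a : nat -> nat -> R) M, (1 <= p)%E -> (forall m n, 0 <= a m n) ->
    (seq_norm p (a 0%N) <= M%:E)%E -> (forall m, a m 0%N = 0) ->
    (forall m, cesaro_le (a m.+1) (a m)) ->
    forall m, (seq_norm p (a m) <= (K * (3 / 4) ^+ m * M)%:E)%E.
Proof.
have [k Hk] := choice cesaro_decay_coord.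
have k0 n : 0 <= k n by have [] := Hk n.
pose N := Num.truncn (2 / (1 - t)).
have N2 : 2 <= N.+2%:R * (1 - t).
  rewrite -ler_pdivrMr ?subr_gt0//.
  by rewrite (le_trans (ltW (truncnS_gt _)))// ler_nat.
(* The inflow from coordinate [N] contributes [k N / (1 - t) = (L - 1) / 4], within the margin
   [3/4 - 1/2]; the summand [1] covers [m = 0]. *)
pose L := 4 * k N / (1 - t) + 1.
have t'0 : 0 < 1 - t by rewrite subr_gt0.
have L0 : 0 <= L by rewrite addr_ge0// divr_ge0 ?mulr_ge0// ltW.
exists (\sum_(i < N.+1) k i + L).
  by rewrite addr_ge0// sumr_ge0.
move=> p a M p1 a0 aM a00 aS.
have M0 := seq_norm_EFin_ge0 aM.
have aM' n : a 0%N n <= M by exact: seq_norm_coord aM.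
have ak m n : a m n <= k n * (3 / 4) ^+ m * M.
  by have [_ /(_ a M M0 a0 aM' a00 aS)] := Hk n.
pose b m n := if (n < N.+1)%N then 0 else a m n.
have b0 m n : 0 <= b m n by rewrite /b; case: ifP.
have bL m : (seq_norm p (b m) <= (L * (3 / 4) ^+ m * M)%:E)%E.
  elim: m => [|m IH].
    apply: (@seq_norm_le _ _ (a 0%N)) => //.
      by move=> n; rewrite b0 /b; case: ifP => _; rewrite ?a0 ?lexx.
    apply: (le_trans aM); rewrite lee_fin expr0 mulr1 ler_peMl// lerDr.
    by rewrite divr_ge0 ?mulr_ge0// ltW.
  pose c := k N * (3 / 4) ^+ m.+1 * M.
  have c0 : 0 <= c by rewrite !mulr_ge0// exprn_ge0.
  (* The tail loses its predecessor at index [N.+1]; the missing term, bounded by [c], is moved to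
     the forcing. *)
  pose g n := c * (n == N.+1)%:R + N.+2%:R^-1 * b m n.
  have gM : (seq_norm p g <= (c * 1 + N.+2%:R^-1 * (L * (3 / 4) ^+ m * M))%:E)%E.
    apply: seq_norm_leD _ (seq_normZ p1 _ c0 (seq_norm_delta N.+1 p1))
      (seq_normZ p1 (b0 m) _ IH) => // n.
    by rewrite lexx addr_ge0 ?mulr_ge0.
  have g0 n : 0 <= g n by rewrite addr_ge0 ?mulr_ge0.
  apply: (le_trans (seq_norm_geometric p1 t0 t1 (b0 m.+1) g0 _ gM)); last first.
    have arith (l y e : R) : 0 <= e -> y <= 2^-1 * (l * e) -> 0 <= l * e ->
      (l - 1) / 4 * (3 / 4 * e) + y <= l * (3 / 4) * e by lra.
    have : 0 <= (3 / 4 : R) ^+ m * M by rewrite mulr_ge0// exprn_ge0.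
    rewrite lee_fin mulr1 /c !exprS.
    have -> : (k N * (3 / 4 * (3 / 4) ^+ m) * M +
        N.+2%:R^-1 * (L * (3 / 4) ^+ m * M)) / (1 - t) =
        k N / (1 - t) * (3 / 4 * ((3 / 4) ^+ m * M)) +
        (N.+2%:R * (1 - t))^-1 * (L * ((3 / 4) ^+ m * M)).
      by rewrite invfM; ring.
    have -> : L * (3 / 4 * (3 / 4) ^+ m) * M = L * (3 / 4) * ((3 / 4) ^+ m * M).
      by ring.
    have : (N.+2%:R * (1 - t))^-1 <= 2^-1.
      by rewrite lef_pV2// posrE// (lt_le_trans _ N2).
    move: (_ * M) => e i2 e0.
    have ile : (N.+2%:R * (1 - t))^-1 * (L * e) <= 2^-1 * (L * e).
      by rewrite ler_wpM2r// mulr_ge0.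
    have kL : k N / (1 - t) = (L - 1) / 4 by rewrite /L; field; rewrite gt_eqF.
    rewrite kL; have : 0 <= L * e by rewrite mulr_ge0.
    by move=> le0; exact: arith.
  move=> n; rewrite {1}/b; case: ltnP => nN.
    by rewrite addr_ge0 ?mulr_ge0//; case: n {nN} => //=.
  case: n nN => // n; rewrite ltnS => nN.
  have -> : g n.+1 = c * (n == N)%:R + N.+2%:R^-1 * a m n.+1.
    by rewrite /g /b ltnS ltnNge nN eqSS.
  have step : a m.+1 n.+1 <= t * a m.+1 n + N.+2%:R^-1 * a m n.+1.
    have := aS m n.+1 => /= aSm.
    have : n.+2%:R * a m.+1 n.+1 <= n.+2%:R * (t * a m.+1 n + n.+2%:R^-1 * a m n.+1).
      rewrite mulrDr mulVKf// (le_trans aSm)// lerD2r mulrCA ler_wpM2r//.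
        by rewrite mulr_ge0.
      by rewrite ler_nat.
    rewrite ler_pM2l// => /le_trans; apply.
    by rewrite lerD2l ler_wpM2r// lef_pV2 ?posrE// ler_nat !ltnS.
  apply: (le_trans step); rewrite addrA lerD2r/= /b ltnS.
  move: nN; rewrite leq_eqVlt => /predU1P[<-|Nn].
    rewrite leqnn eqxx mulr0 add0r mulr1 -[leRHS]mul1r.
    by apply: ler_pM => //; exact: ltW.
  by rewrite leqNgt Nn/= gtn_eqF// mulr0 addr0.
move=> m; rewrite mulrDl mulrDl; apply: seq_norm_leD _ _ (bL m) => //; last first.
  apply: (le_trans (seq_norm_trunc_le N.+1 p1 (a0 m))).
  rewrite lee_fin -mulrA mulr_suml; apply: ler_sum => i _.
  by rewrite mulrA ak.
move=> n; rewrite a0/= /seq_trunc /b.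
by case: ltnP; rewrite ?addr0 ?add0r.
Qed.

End CesaroRecurrence.

(** * Complex sequences and operators *)

Local Open Scope complex_scope.

Section ComplexModulus.
Context (R : realType).
Implicit Types a b : R[i].

Lemma normR_real (r : R) : normR r%:C = `|r|.
Proof. by rewrite /normR normc_def/= expr0n addr0 sqrtr_sqr. Qed.

Lemma normR0 (V : normedZmodType R[i]) : normR (0 : V) = 0.
Proof. by rewrite /normR normr0. Qed.

Lemma normR1 : normR (1 : R[i]) = 1.
Proof. by rewrite /normR normr1. Qed.

Lemma normR_nat n : normR (n%:R : R[i]) = n%:R.
Proof. by apply: complexI; rewrite normRE normr_nat rmorph_nat. Qed.

Lemma normRV a : normR a^-1 = (normR a)^-1.
Proof. by apply: complexI; rewrite fmorphV/= !normRE normfV. Qed.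

Lemma normRN (V : normedZmodType R[i]) (x : V) : normR (- x) = normR x.
Proof. by rewrite /normR normrN. Qed.

Lemma normRZ (V : normedModType R[i]) a (x : V) : normR (a *: x) = normR a * normR x.
Proof. by apply: complexI; rewrite rmorphM/= !normRE normrZ. Qed.

Lemma normR_gt0 (V : normedZmodType R[i]) (x : V) : (0 < normR x) = (x != 0).
Proof.
rewrite lt_def normR_ge0 andbT; congr negb.
by apply/eqP/eqP => [/normR_eq0|->]; rewrite ?normR0.
Qed.

Lemma normRB (V : normedZmodType R[i]) (x y : V) : normR (x - y) <= normR x + normR y.
Proof. by rewrite (le_trans (normRD _ _))// normRN. Qed.

Lemma normR_sum (V : normedZmodType R[i]) (I : Type) (s : seq I) P (F : I -> V) :
  normR (\sum_(i <- s | P i) F i) <= \sum_(i <- s | P i) normR (F i).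
Proof.
elim/big_ind2 : _ => //; first by rewrite normR0.
by move=> x1 x2 y1 y2 h1 h2; rewrite (le_trans (normRD _ _))// lerD.
Qed.

Lemma normR_le_ReIm a : normR a <= `|complex.Re a| + `|complex.Im a|.
Proof.
rewrite {1}[a]complexE (le_trans (normRD _ _))// normRM !normR_real.
suff -> : normR ('i%C : R[i]) = 1 by rewrite mul1r.
by rewrite /normR normc_def/= expr0n/= expr1n add0r sqrtr1.
Qed.

Lemma Re_le_normR a : `|complex.Re a| <= normR a.
Proof. by rewrite -lecR normRE normc_ge_Re. Qed.

Lemma Im_le_normR a : `|complex.Im a| <= normR a.
Proof.
rewrite /normR normc_def/= -{1}sqrtr_sqr ler_wsqrtr// lerDr sqr_ge0//.
Qed.

End ComplexModulus.

Section EllInterface.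
Context (R : realType) (p : \bar R) (p1 : (1 <= p)%E).
Implicit Types (x y : ell p1) (u v : nat -> R[i]) (M : R).

Definition seq_mod u n : R := normR (u n).

Lemma seq_mod_ge0 u n : 0 <= seq_mod u n. Proof. exact: normR_ge0. Qed.

Lemma ell_normRE x : seq_norm p (seq_mod x) = (normR x)%:E.
Proof. by rewrite normR_ell. Qed.

Lemma ell_normR_le x M : (normR x <= M) = (seq_norm p (seq_mod x) <= M%:E)%E.
Proof. by rewrite ell_normRE lee_fin. Qed.

Lemma ell_memP u M : (seq_norm p (seq_mod u) <= M%:E)%E -> u \in ell_mem p.
Proof. by move=> uM; rewrite unfold_in (le_lt_trans uM)// ltry. Qed.

Definition ell_mk u M (uM : (seq_norm p (seq_mod u) <= M%:E)%E) : ell p1 :=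
  exist _ u (ell_memP uM).

Lemma ell_mkE u M (uM : (seq_norm p (seq_mod u) <= M%:E)%E) n : ell_mk uM n = u n.
Proof. by []. Qed.

Lemma ell_ext x y : (forall n, x n = y n) -> x = y.
Proof. by move=> xy; apply/val_inj/funext. Qed.

Lemma ellD x y n : (x + y : ell p1) n = x n + y n. Proof. by []. Qed.
Lemma ellZ a x n : (a *: x : ell p1) n = a * x n. Proof. by []. Qed.
Lemma ellN x n : (- x : ell p1) n = - x n. Proof. by []. Qed.
Lemma ell0 n : (0 : ell p1) n = 0. Proof. by []. Qed.

Lemma ell_coord_le x n : normR (x n) <= normR x.
Proof.
by move: (lexx (normR x)); rewrite ell_normR_le => /(seq_norm_coord n p1 (seq_mod_ge0 x)).
Qed.

Lemma seq_norm_mod_delta k : (seq_norm p (seq_mod (fun n => (n == k)%:R)) <= 1%:E)%E.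
Proof.
suff -> : seq_mod (fun n => (n == k)%:R) = (fun n => (n == k)%:R).
  exact: seq_norm_delta.
by apply/funext => n; rewrite /seq_mod normR_nat.
Qed.

Definition ell_delta k : ell p1 := ell_mk (seq_norm_mod_delta k).

Lemma ell_deltaE k n : ell_delta k n = (n == k)%:R. Proof. by []. Qed.

Lemma normR_ell_delta k : normR (ell_delta k) = 1.
Proof.
apply/eqP; rewrite eq_le ell_normR_le seq_norm_mod_delta/=.
by rewrite (le_trans _ (ell_coord_le _ k))// ell_deltaE eqxx normR1.
Qed.

End EllInterface.

Section OperatorNorm.
Context (R : realType) (V : normedModType R[i]).
Implicit Types (S T : V -> V) (K : R).

Lemma op_norm_ge T x : normR x <= 1 -> ((normR (T x))%:E <= op_norm T)%E.
Proof. by move=> x1; apply: ereal_sup_ubound; exists x. Qed.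

Lemma op_norm_ge0 T : T 0 = 0 -> (0 <= op_norm T)%E.
Proof.
move=> T0; have := @op_norm_ge T 0; rewrite T0 normR0; apply.
exact: ler01.
Qed.

Lemma op_norm_le T K : 0 <= K -> (forall x, normR (T x) <= K * normR x) ->
  (op_norm T <= K%:E)%E.
Proof.
move=> K0 TK; apply: ge_ereal_sup => _ [x /= x1 <-]; rewrite lee_fin.
by rewrite (le_trans (TK x))// ler_piMr.
Qed.

Lemma bounded_operator_le T K : linear T -> (forall x, normR (T x) <= K * normR x) ->
  bounded_operator T.
Proof.
move=> Tl TK; split=> //.
apply: (@le_lt_trans _ _ (`|K|)%:E); last by rewrite ltry.
apply: op_norm_le => // x; rewrite (le_trans (TK x))// ler_wpM2r ?normR_ge0//.
exact: ler_norm.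
Qed.

End OperatorNorm.

(** * The operator and its orbits *)

Section CesaroEquation.
Context (R : realType) (t : R).
Implicit Types (x z : nat -> R[i]).

Lemma gen_cesaroE x n :
  n.+1%:R * gen_cesaro t x n = t%:C * (n%:R * seq_shift (gen_cesaro t x) n) + x n.
Proof.
have sumE m : m.+1%:R * gen_cesaro t x m = \sum_(i < m.+1) (t ^+ (m - i))%:C * x i.
  by rewrite mulrC mulfVK.
case: n => [|n]; rewrite sumE.
  by rewrite big_ord_recl big_ord0 subnn expr0 mul1r addr0 mul0r mulr0 add0r.
rewrite /= sumE big_ord_recr/= subnn expr0 mul1r; congr (_ + _).
rewrite mulr_sumr; apply: eq_bigr => i _.
by rewrite subSn ?leq_ord// exprS rmorphM/= mulrA.
Qed.

Lemma gen_cesaro_unique x z :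
  (forall n, n.+1%:R * z n = t%:C * (n%:R * seq_shift z n) + x n) ->
  z =1 gen_cesaro t x.
Proof.
move=> zE; elim=> [|n IH].
  have /(_ 0%N) := zE; have := gen_cesaroE x 0; rewrite /= !mul0r !mulr0 !add0r.
  by rewrite !mul1r => -> ->.
apply: (@mulfI _ n.+2%:R); first by rewrite pnatr_eq0.
by rewrite zE gen_cesaroE /= IH.
Qed.

Lemma gen_cesaro_linear a x z n :
  gen_cesaro t (fun n => a * x n + z n) n = a * gen_cesaro t x n + gen_cesaro t z n.
Proof.
rewrite /gen_cesaro mulrA -mulrDl mulr_sumr -big_split/=; congr (_ / _).
by apply: eq_bigr => i _; rewrite mulrDr mulrCA.
Qed.

Lemma seq_mod_shift z n : seq_mod (seq_shift z) n = seq_shift (seq_mod z) n.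
Proof. by case: n => //=; rewrite /seq_mod/= normR0. Qed.

Hypothesis t0 : 0 <= t.

Lemma cesaro_le_gen_cesaro x : cesaro_le t (seq_mod (gen_cesaro t x)) (seq_mod x).
Proof.
move=> n; rewrite -seq_mod_shift /seq_mod -!(normR_nat R) -{2}(ger0_norm t0) -normR_real.
by rewrite -!normRM gen_cesaroE normRD.
Qed.

End CesaroEquation.

Section CesaroOperator.
Context (R : realType) (t : R) (t0 : 0 <= t) (t1 : t < 1).
Context (p : \bar R) (p1 : (1 <= p)%E).
Implicit Types x y : ell p1.

Lemma gen_cesaro_mem x :
  (seq_norm p (seq_mod (gen_cesaro t x)) <= (normR x / (1 - t))%:E)%E.
Proof.
apply: (cesaro_le_norm t0 t1) (cesaro_le_gen_cesaro t0 x) _ => //.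
- exact: seq_mod_ge0.
- exact: seq_mod_ge0.
- by rewrite ell_normRE.
Qed.

Definition cesaro_op x : ell p1 := ell_mk p1 (gen_cesaro_mem x).
Local Notation T := cesaro_op.

Lemma cesaro_opE x n : T x n = gen_cesaro t x n. Proof. by []. Qed.

Lemma cesaro_op_rec x n :
  n.+1%:R * T x n = t%:C * (n%:R * seq_shift (T x) n) + x n.
Proof. exact: gen_cesaroE. Qed.

(** Values of the operator on eigenvectors, on resolvents and on the fixed vector are all verified
    through the recurrence instead of the defining sum. *)
Lemma cesaro_op_eq x y :
  (forall n, n.+1%:R * y n = t%:C * (n%:R * seq_shift y n) + x n) -> T x = y.
Proof. by move=> /gen_cesaro_unique yE; apply: ell_ext => n; rewrite yE. Qed.

Lemma cesaro_op_linear : linear T.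
Proof. by move=> a x y; apply: ell_ext => n; exact: gen_cesaro_linear. Qed.

HB.instance Definition _ := GRing.isLinear.Build R[i] (ell p1) (ell p1) _ T
  cesaro_op_linear.

Lemma cesaro_op_le x : normR (T x) <= (1 - t)^-1 * normR x.
Proof. by rewrite mulrC ell_normR_le gen_cesaro_mem. Qed.

Lemma cesaro_op_bounded : bounded_operator T.
Proof. exact: bounded_operator_le cesaro_op_linear cesaro_op_le. Qed.

Lemma cesaro_op_weighted x :
  (seq_norm p (fun n => n.+1%:R * seq_mod (T x) n)%R <= (normR x / (1 - t))%:E)%E.
Proof.
apply: (cesaro_le_weighted t0 t1) (cesaro_le_gen_cesaro t0 x) _ => //.
- exact: seq_mod_ge0.
- exact: seq_mod_ge0.
- by rewrite ell_normRE.
Qed.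

Lemma cesaro_op_not_supercyclic : ~ supercyclic T.
Proof.
move=> [x' dx']; pose x : ell p1 := x'.
have {dx'}dx : dense [set y : ell p1 | exists l : R[i], exists n, y = l *: iter n T x].
  exact: dx'.
have approx (y : ell p1) (e : R) : 0 < e -> exists l n,
    normR (y - l *: iter n T x) < e.
  move=> e0; have [||z] := dx (ball y e%:C).
  - by exists y; apply: ballxx; rewrite ltcR.
  - exact: ball_open.
  - rewrite -ball_normE /= => -[/= yz [l [n zE]]].
    by exists l, n; rewrite -ltcR normRE -zE.
have iter0 n : iter n T x 0%N = x 0%N.
  elim: n => //= n IH; have := cesaro_op_rec (iter n T x) 0.
  by rewrite mul0r mulr0 add0r mul1r IH.
(* If [x_0 = 0], all multiples of the orbit stay in this hyperplane, at distance at least [1] from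
   [e_0]. *)
have [x00|x00] := eqVneq (x 0%N) 0.
  have [l [n]] := approx (ell_delta p1 0) 1 ltr01.
  rewrite ltNge => /negP; apply; apply: le_trans (ell_coord_le _ 0).
  by rewrite ellD ellN ellZ iter0 x00 mulr0 oppr0 addr0 ell_deltaE normR1.
(* [x |-> x_1 - t x_0] is an eigenvector of the adjoint for 1/2, [x |-> x_0] one
   for 1. *)
pose phi y := y 1%N - t%:C * y 0%N.
have phiT y : phi (T y) = 2^-1 * phi y.
  rewrite /phi; have := cesaro_op_rec y 1; have := cesaro_op_rec y 0.
  rewrite /= mul0r mulr0 add0r !mul1r => -> E.
  have -> : y 1%N = 2 * T y 1%N - t%:C * y 0%N by rewrite E; ring.
  by field.
have phi_iter n : normR (phi (iter n T x)) <= normR (phi x).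
  elim: n => //= n IH; rewrite phiT normRM normRV normR_nat.
  rewrite (le_trans _ IH)// ler_piMl ?normR_ge0// invf_le1//.
  by rewrite ler1n.
have phiZ (l : R[i]) y : phi (l *: y) = l * phi y by rewrite /phi !ellZ; ring.
(* Along the orbit [phi] shrinks while [x_0] is constant, so [|phi y| <= C |y_0|] for every multiple
   [y]. The vector [e_1] has [phi e_1 = 1] and zeroth entry [0]: approximating it within [e] would
   give [1 <= (C + 2) e]. *)
pose C := normR (phi x) / normR (x 0%N).
have x0gt : 0 < normR (x 0%N) by rewrite normR_gt0.
have C0 : 0 <= C by rewrite divr_ge0 ?normR_ge0.
have e0 : 0 < (C + 3)^-1 by rewrite invr_gt0 ltr_wpDl.
have [l [n]] := approx (ell_delta p1 1) _ e0.
set y : ell p1 := l *: iter n T x => ye.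
have := le_lt_trans (ell_coord_le _ 0) ye; have := le_lt_trans (ell_coord_le _ 1) ye.
rewrite !ellD !ellN !ell_deltaE /= sub0r normRN => y1 y0.
have phiy : normR (phi y) <= C * normR (y 0%N).
  rewrite phiZ ellZ iter0 !normRM mulrCA ler_wpM2l ?normR_ge0//.
  by rewrite mulfVK ?gt_eqF.
have : 1 <= normR (1 - y 1%N) + normR (phi y) + t * normR (y 0%N).
  rewrite -[X in X <= _](normR1 R).
  have {1}-> : 1 = (1 - y 1%N) + phi y + t%:C * y 0%N by rewrite /phi; ring.
  rewrite (le_trans (normRD _ _))// lerD ?normRD//.
  by rewrite normRM normR_real ger0_norm.
have : t * normR (y 0%N) <= normR (y 0%N) by rewrite ler_piMl ?normR_ge0 ?(ltW t1).
have : C * normR (y 0%N) <= C * (C + 3)^-1 by rewrite ler_wpM2l// ltW.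
have : (C + 3) * (C + 3)^-1 = 1 by rewrite divff// gt_eqF// ltr_wpDl.
have := normR_ge0 (y 0%N).
nra.
Qed.

End CesaroOperator.

(** * Compactness *)

Section Compactness.
Context (R : realType) (p : \bar R) (p1 : (1 <= p)%E).

Lemma filter_forall_lt T (F : set_system T) (P : nat -> set T) N :
  Filter F -> (forall n, F (P n)) -> F [set x | forall n, (n < N)%N -> P n x].
Proof.
move=> FF FP; elim: N => [|N IH].
  by apply: filterS filterT => x _ n.
apply: filterS (filterI IH (FP N)) => x [xN PN] n.
by rewrite ltnS leq_eqVlt => /predU1P[->//|/xN].
Qed.

Lemma fmap_ultra T U (f : T -> U) (F : set_system T) :
  UltraFilter F -> UltraFilter (f @ F).
Proof.
move=> FU; split=> [|G GF FG]; first exact: fmap_proper_filter.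
rewrite predeqE => A; split; last exact: FG.
move=> GA; have [//|FnA] := in_ultra_setVsetC (f @^-1` A) FU.
have /filterI/(_ GA) : G (~` A) by exact: FG.
by rewrite setICl => /filter_ex[].
Qed.

(** The image ultrafilter lives on a compact segment, hence converges; this replaces the extraction
    of a diagonal subsequence. *)
Lemma ultra_real_limit T (F : set_system T) (f : T -> R) (M : R) :
  UltraFilter F -> F [set x | `|f x| <= M] ->
  exists a, forall e : R, 0 < e -> F [set x | `|a - f x| < e].
Proof.
move=> FU FM; have FI : F (f @^-1` `[- M, M]).
  by apply: filterS FM => x /=; rewrite ler_norml in_itv.
have := @segment_compact R (- M) M.
rewrite compact_ultra => /(_ (f @ F)) [].
- exact: fmap_ultra.
- exact: FI.
move=> a [_ fa]; exists a => e e0.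
by have := fa _ (nbhsx_ballx a _ e0); rewrite -ball_normE.
Qed.

Lemma ultra_complex_limit T (F : set_system T) (f : T -> R[i]) (M : R) :
  UltraFilter F -> F [set x | normR (f x) <= M] ->
  exists a, forall e : R, 0 < e -> F [set x | normR (a - f x) < e].
Proof.
move=> FU FM.
have [a ax] : exists a, forall e : R, 0 < e -> F [set x | `|a - complex.Re (f x)| < e].
  apply: (@ultra_real_limit _ F (fun x => complex.Re (f x)) M).
  apply: filterS FM => x /=; exact: le_trans (Re_le_normR _).
have [b bx] : exists a, forall e : R, 0 < e -> F [set x | `|a - complex.Im (f x)| < e].
  apply: (@ultra_real_limit _ F (fun x => complex.Im (f x)) M).
  apply: filterS FM => x /=; exact: le_trans (Im_le_normR _).
exists (Complex a b) => e e0.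
apply: filterS (filterI (ax (e / 2) _) (bx (e / 2) _)); rewrite ?divr_gt0// => x [/= xa xb].
apply: (le_lt_trans (normR_le_ReIm _)); move: xa xb.
case: (f x) => c d /= xa xb; rewrite (splitr e); exact: ltrD.
Qed.

(* A weight tending to infinity makes the tails uniformly small, so that on this
   set norm convergence reduces to coordinatewise convergence. *)
Lemma compact_weighted_ball (M : R) :
  compact [set y : ell p1 |
    (seq_norm p (fun n => n.+1%:R * seq_mod y n)%R <= M%:E)%E].
Proof.
rewrite compact_ultra => F FU FK.
have FF : Filter F by apply: ultra_proper.
have w0 (u : nat -> R[i]) n : 0 <= n.+1%:R * seq_mod u n by rewrite mulr_ge0 ?seq_mod_ge0.
have coordM n : F [set y : ell p1 | normR (y n) <= M].
  apply: filterS FK => y /= yM.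
  apply: le_trans (seq_norm_coord n p1 (w0 y) yM).
  by rewrite ler_peMl ?seq_mod_ge0// ler1n.
have [u Fu] := choice (fun n => ultra_complex_limit FU (coordM n)).
have Fu_unif (e : R) N : 0 < e ->
    F [set y : ell p1 | forall n, (n < N)%N -> normR (u n - y n) < e].
  move=> e0.
  apply: (filter_forall_lt (P := fun n (y : ell p1) => normR (u n - y n) < e)) => n.
  exact: Fu.
have tri (y : ell p1) n : seq_mod u n <= seq_mod y n + normR (u n - y n).
  by rewrite /seq_mod (le_trans _ (normRD _ _))// subrKC.
have uM : (seq_norm p (fun n => n.+1%:R * seq_mod u n)%R <= M%:E)%E.
  apply: seq_norm_trunc_sup => // N; apply/lee_addgt0Pr => e e0.
  (* As [S] exceeds the sum of the first [N] weights, replacing [u] by a [y] within [e / S] in these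
     coordinates costs at most [e] in the weighted norm. *)
  pose S : R := \sum_(i < N) i.+1%:R + 1.
  have S0 : 0 < S by rewrite ltr_wpDl// sumr_ge0.
  have eS : 0 < e / S by rewrite divr_gt0.
  have [y [yM yu]] := filter_ex (filterI FK (Fu_unif _ N eS)).
  pose d n := n.+1%:R * (e / S).
  have d0 n : 0 <= d n by rewrite mulr_ge0// ltW.
  rewrite -EFinD; apply: (seq_norm_leD p1 _ yM (g := seq_trunc N d)).
    move=> n; rewrite (seq_trunc_ge0 _ (w0 u))/= /seq_trunc.
    case: ifPn => nN; last by rewrite addr0.
    rewrite /d -mulrDr ler_wpM2l// (le_trans (tri y n))// lerD2l ltW//.
    exact: yu.
  apply: (le_trans (seq_norm_trunc_le _ p1 d0)).
  rewrite lee_fin -mulr_suml mulrCA ler_piMr ?ltW//.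
  by rewrite ltr_pdivrMr// mul1r ltrDl.
have u_mem : (seq_norm p (seq_mod u) <= M%:E)%E.
  apply: seq_norm_le _ uM => // n; rewrite seq_mod_ge0/=.
  by rewrite ler_peMl ?seq_mod_ge0// ler1n.
exists (ell_mk p1 u_mem); split => //=.
apply/cvgrPdist_lt => e e0.
have eR : 0 < complex.Re e by move: e0; rewrite ltcE => /andP[].
have M0 := seq_norm_EFin_ge0 uM.
(* From index [N] on, [u - y] has norm at most [2 M / (N + 1)], less than half of the radius; the
   [N] coordinates before it share the other half. *)
pose N := Num.truncn (4 * M / complex.Re e).
have N1 : (M + M) / N.+1%:R < complex.Re e / 2.
  rewrite ltr_pdivrMr//.
  have := truncnS_gt (4 * M / complex.Re e); rewrite -/N.
  rewrite ltr_pdivrMr//; lra.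
have eN : 0 < complex.Re e / 2 / N.+1%:R by rewrite !divr_gt0.
suff near_u (y : ell p1) : (seq_norm p (fun n => n.+1%:R * seq_mod y n)%R <= M%:E)%E ->
    (forall n, (n < N)%N -> normR (u n - y n) < complex.Re e / 2 / N.+1%:R) ->
    normR (ell_mk p1 u_mem - y) < complex.Re e.
  apply: filterS (filterI FK (Fu_unif _ N eN)) => y [/= yM yu].
  by rewrite -normRE -[e]RRe_real ?gtr0_real// ltcR; exact: near_u.
move=> yM yu.
apply: (@le_lt_trans _ _ (complex.Re e / 2 / N.+1%:R * N%:R +
    N.+1%:R^-1 * (M + M))); last first.
  rewrite [ltRHS]splitr ler_ltD//; last by rewrite mulrC.
  rewrite -mulrA ler_piMr//; first by rewrite divr_ge0// ltW.
  by rewrite mulrC ler_pdivrMr// mul1r ler_nat.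
rewrite ell_normR_le.
pose c (n : nat) : R := complex.Re e / 2 / N.+1%:R.
have wMM : (seq_norm p (fun n => (n.+1%:R * seq_mod u n + n.+1%:R * seq_mod y n)%R)
    <= (M + M)%:E)%E.
  by apply: seq_norm_leD uM yM => // n; rewrite lexx addr_ge0.
apply: (@seq_norm_leD _ _ (seq_trunc N c)
  (fun n => N.+1%:R^-1 * (n.+1%:R * seq_mod u n + n.+1%:R * seq_mod y n))) => //.
- move=> n; rewrite seq_mod_ge0/= /seq_trunc.
  case: ltnP => [nN|Nn].
    rewrite (le_trans (ltW (yu n nN)))// lerDl mulr_ge0//.
    by rewrite addr_ge0.
  rewrite add0r -mulrDr mulrA (le_trans (normRB _ _))// ler_peMl//.
    by rewrite addr_ge0 ?seq_mod_ge0.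
  by rewrite mulrC ler_pdivlMr// mul1r ler_nat ltnS.
- apply: (le_trans (seq_norm_trunc_le _ p1 _)) => [n|]; first exact: ltW.
  by rewrite lee_fin sumr_const card_ord mulr_natr.
- by apply: seq_normZ => // n; rewrite addr_ge0.
Qed.

End Compactness.

Lemma cesaro_op_compact (R : realType) (t : R) (t0 : 0 <= t) (t1 : t < 1)
  (p : \bar R) (p1 : (1 <= p)%E) : compact_operator (cesaro_op t0 t1 (p1 := p1)).
Proof.
split; first exact: cesaro_op_bounded.
have K := @compact_weighted_ball R p p1 (1 - t)^-1.
apply: precompact_subset (compact_precompact _ K); last exact: norm_hausdorff.
move=> _ [x x1 <-] /=; apply: (le_trans (cesaro_op_weighted _ _ x)).
by rewrite lee_fin mulrC ler_piMr// invr_ge0 subr_ge0 ltW.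
Qed.

(** * Spectrum *)

Section Spectrum.
Context (R : realType) (t : R) (t0 : 0 <= t) (t1 : t < 1).
Implicit Types (c : R) (l : R[i]).

(** The ratios of the perturbed recurrences tend to [t], so they eventually stay below this midpoint
    of [t] and [1]. *)
Local Notation r := ((1 + t) / 2).

Let r0 : 0 < r. Proof. by rewrite divr_gt0// ltr_wpDr. Qed.
Let r1 : r < 1. Proof. by rewrite ltr_pdivrMr//; move: t1; lra. Qed.

Lemma eventually_ratio_le c : exists N0, forall n, (N0 <= n)%N ->
  1 <= n.+1%:R - c /\ t * n%:R <= r * (n%:R - c).
Proof.
(* Since [r - t = (1 - t) / 2], this threshold gives [(r - t) n >= |c|], which dominates [r c]. *)
exists (Num.truncn (2 * `|c| / (1 - t))).+1 => n nN.
have : 2 * `|c| / (1 - t) <= n%:R.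
  by apply: (le_trans (ltW (truncnS_gt _))); rewrite ler_nat.
rewrite ler_pdivrMr ?subr_gt0// => cn; have := ler_norm c; have := normr_ge0 c.
have := ler0n R n; move: t0 t1 cn; rewrite -[n.+1%:R]natr1; move: (n%:R) (`|c|) => m d.
move=> t0' t1' dm m0 d0 cd.
have mt : 0 <= m * t by rewrite mulr_ge0.
have dt : 0 <= d * (1 - t) by rewrite mulr_ge0// subr_ge0 ltW.
have dct : 0 <= (d - c) * (1 + t) by rewrite mulr_ge0 ?subr_ge0// addr_ge0.
by split; lra.
Qed.

Lemma recurrence_ratio_bound (d : nat -> R) c : (forall n, 0 < d n) ->
  (forall n, n.+1%:R - c <= d n) ->
  exists2 K, 0 <= K & forall p (z y : nat -> R) M, (1 <= p)%E ->
    (forall n, 0 <= z n) -> (forall n, 0 <= y n) ->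
    (forall n, d n * z n <= t * (n%:R * seq_shift z n) + y n) ->
    (seq_norm p y <= M%:E)%E -> (seq_norm p z <= (K * M)%:E)%E.
Proof.
move=> d0 dc; have [N0 HN] := eventually_ratio_le c.
pose A n := t * n%:R / d n.
(* A common bound of all [1 / d n]: the sum covers [n < N0], and [1] covers the rest, where
   [d n >= 1]. *)
pose B := \sum_(i < N0) (d i)^-1 + 1.
have dB n : (d n)^-1 <= B.
  have [nN|Nn] := ltnP n N0.
    rewrite /B (bigD1 (Ordinal nN))//= -addrA lerDl addr_ge0// sumr_ge0// => i _.
    by rewrite invr_ge0 ltW.
  have [d1 _] := HN n Nn.
  have : (d n)^-1 <= 1 by rewrite invf_le1// (le_trans d1).
  by move/le_trans; apply; rewrite lerDr sumr_ge0// => i _; rewrite invr_ge0 ltW.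
have A0 n : 0 <= A n by rewrite divr_ge0 ?mulr_ge0// ltW.
have Ar n : (N0 <= n)%N -> A n <= r.
  move=> /HN[_ h]; rewrite ler_pdivrMr// (le_trans h)// ler_wpM2l ?(ltW r0)//.
  by rewrite (le_trans _ (dc n))// lerD2r ler_nat.
have B0 : 0 <= B by rewrite addr_ge0// sumr_ge0// => i _; rewrite invr_ge0 ltW.
have [K K0 HK] := recurrence_seq_norm B0 r0 r1 A0 Ar.
exists K => // p z y M p1 z0 y0 zy; apply: HK => // n.
have -> : z n = (d n)^-1 * (d n * z n) by rewrite mulKf// gt_eqF.
apply: (@le_trans _ _ ((d n)^-1 * (t * (n%:R * seq_shift z n) + y n))).
  by rewrite ler_wpM2l// invr_ge0 ltW.
rewrite mulrDr lerD//; last by rewrite ler_wpM2r.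
by rewrite /A le_eqVlt; apply/orP; left; apply/eqP; ring.
Qed.

Context (p : \bar R) (p1 : (1 <= p)%E).
Implicit Types (x y : ell p1).
Local Notation T := (cesaro_op t0 t1 (p1 := p1)).

(** For the eigenvalue [1/(n+1)] the equation reads [(k - n) x_k = t k x_(k-1)], solved by these
    binomial terms. It degenerates at [k = n], so for [k <= n] the coefficient [k - n] is replaced
    by [1] and the entry [x_n = 1] is supplied by the forcing. *)
Lemma eigenvector_mem n : exists M,
  (seq_norm p (seq_mod (fun k => ('C(k, n)%:R * t ^+ (k - n))%:C)) <= M%:E)%E.
Proof.
have [|k|K K0 HK] := @recurrence_ratio_bound
    (fun k => if (k <= n)%N then 1 else k%:R - n%:R) n.+1%:R.
- by move=> k; case: leqP => // nk; rewrite subr_gt0 ltr_nat.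
- case: leqP => // nk; first by rewrite (@le_trans _ _ 0)// subr_le0 ler_nat ltnS.
  by rewrite -!natr1; lra.
exists (K * 1); apply: (HK p _ (fun k => (k == n)%:R)) => //.
- by move=> k; exact: seq_mod_ge0.
- move=> k; rewrite -seq_mod_shift /seq_mod.
  case: k => [|k] /=; rewrite ?normR0 ?normR_real.
    rewrite mul1r !mulr0 add0r sub0n expr0 mulr1.
    by rewrite bin0n eq_sym normr_nat.
  have u0 j : 0 <= 'C(j, n)%:R * t ^+ (j - n) by rewrite mulr_ge0// exprn_ge0.
  rewrite !ger0_norm//; case: (ltngtP k.+1 n) => kn.
  + by rewrite bin_small// mul0r mulr0 addr_ge0// !mulr_ge0// exprn_ge0.
  + rewrite addr0 subSn// exprS -natrB; last exact: ltnW.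
    rewrite mulrA -natrM -mul_bin_down natrM /= le_eqVlt; apply/orP; left; apply/eqP.
    by ring.
  + by rewrite kn binn subnn expr0 !mul1r lerDr !mulr_ge0// exprn_ge0.
- exact: seq_norm_delta.
Qed.

(** Once the earlier entries vanish, the equation leaves [((n + 1) l - 1) x_n = 0]. This includes
    [l = 0]. *)
Lemma cesaro_eigen_eq0 l x : l \notin Lambda R -> T x = l *: x -> x = 0.
Proof.
rewrite notin_setE => lL Tx; apply: ell_ext; elim=> [|n IH].
  have := cesaro_op_rec t0 t1 x 0; rewrite /= mul0r mulr0 add0r mul1r Tx ellZ.
  move/eqP; rewrite -subr_eq0 -{2}[x 0%N]mul1r -mulrBl mulf_eq0 subr_eq0.
  by case/orP => /eqP// l1; case: lL; exists 0%N => //; rewrite l1 invr1.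
have := cesaro_op_rec t0 t1 x n.+1; rewrite /= Tx !ellZ IH ell0 !mulr0 add0r.
move/eqP; rewrite -subr_eq0 -{2}[x n.+1]mul1r mulrA -mulrBl mulf_eq0 subr_eq0.
case/orP => /eqP// l1; case: lL; exists n.+1 => //.
by apply: (@mulfI _ n.+2%:R); rewrite ?pnatr_eq0// l1 divff// pnatr_eq0.
Qed.

Lemma cesaro_point_spectrum : point_spectrum T = Lambda R.
Proof.
rewrite eqEsubset; split=> l.
  case=> x x0 Tx; apply: contrapT => lL; rewrite -notin_setE in lL.
  by move/eqP: x0; apply; exact: (cesaro_eigen_eq0 lL).
case=> n _ <-; have [M uM] := eigenvector_mem n.
pose u : ell p1 := ell_mk p1 uM.
exists u.
  apply/eqP => /(congr1 (fun x : ell p1 => x n)) /eqP.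
  by rewrite ell0 ell_mkE binn subnn expr0 mul1r oner_eq0.
apply: cesaro_op_eq => k; rewrite ellZ ell_mkE.
have -> : seq_shift (n.+1%:R^-1 *: u : ell p1) k = n.+1%:R^-1 * seq_shift u k.
  by case: k => [|k] //=; rewrite mulr0.
apply: (@mulfI _ n.+1%:R); first by rewrite pnatr_eq0.
rewrite mulrCA mulVKf ?pnatr_eq0// mulrDr [RHS]addrC mulrCA [_ * (k%:R * _)]mulrCA.
rewrite mulVKf ?pnatr_eq0// addrC; apply/eqP; rewrite -subr_eq -mulrBl; apply/eqP.
case: k => [|k] /=.
  rewrite !mulr0 sub0n expr0 mulr1.
  by rewrite bin0n; case: eqVneq => [->|_]; rewrite ?subrr ?mul0r ?mulr0.
rewrite ell_mkE.
have [kn|nk] := ltnP k n.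
  rewrite [in RHS]bin_small// mul0r !mulr0.
  move: kn; rewrite leq_eqVlt => /predU1P[->|kn]; first by rewrite subrr mul0r.
  by rewrite bin_small// mul0r mulr0.
rewrite subSn// exprS.
have E : (k.+1%:R - n%:R) * 'C(k.+1, n)%:R = k.+1%:R * 'C(k, n)%:R :> R[i].
  by rewrite -natrB ?(leqW nk)// -!natrM -mul_bin_down.
have -> : k.+2%:R - n.+1%:R = k.+1%:R - n%:R :> R[i] by rewrite -!natr1; ring.
by rewrite !rmorphM/= !rmorph_nat [LHS]mulrA E; ring.
Qed.

(* [z = C_t x] for the solution [x] of [l x - C_t x = y], obtained by substituting
   [x = (y + z) / l] in [(n + 1) z_n = t n z_(n-1) + x_n]. *)
Fixpoint resolvent_sol l (y : nat -> R[i]) n : R[i] :=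
  ((if n is m.+1 then t%:C * (m.+1%:R * resolvent_sol l y m) else 0) + y n / l)
  / (n.+1%:R - l^-1).

Lemma resolvent_sol_den_neq0 l n : l \notin Lambda0 R -> n.+1%:R - l^-1 != 0.
Proof.
rewrite notin_setE => lL; rewrite subr_eq0; apply/eqP => nl; apply: lL; left.
by exists n => //; rewrite nl invrK.
Qed.

Lemma resolvent_solE l (y : nat -> R[i]) n : l \notin Lambda0 R ->
  (n.+1%:R - l^-1) * resolvent_sol l y n =
  t%:C * (n%:R * seq_shift (resolvent_sol l y) n) + y n / l.
Proof.
move=> lL; rewrite mulrC; case: n => [|n] /=; rewrite mulfVK ?resolvent_sol_den_neq0//.
by rewrite mul0r mulr0.
Qed.

Lemma resolvent_sol_linear l a (y z : nat -> R[i]) n :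
  resolvent_sol l (fun n => a * y n + z n) n =
  a * resolvent_sol l y n + resolvent_sol l z n.
Proof. by elim: n => [|n IH] /=; rewrite ?IH; ring. Qed.

Lemma resolvent_sol_bound l : l \notin Lambda0 R -> exists2 K, 0 <= K &
  forall y, (seq_norm p (seq_mod (resolvent_sol l y)) <= (K * normR y)%:E)%E.
Proof.
move=> lL.
have [n|n|K K0 HK] := @recurrence_ratio_bound
    (fun n => normR (n.+1%:R - l^-1)) (normR l^-1).
- by rewrite normR_gt0 resolvent_sol_den_neq0.
- have := normRD (n.+1%:R - l^-1) l^-1; rewrite subrK normR_nat; lra.
exists (K * normR l^-1); first by rewrite mulr_ge0 ?normR_ge0.
move=> y; rewrite -mulrA.
apply: (HK p _ (fun n => normR l^-1 * seq_mod y n)) => //.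
- by move=> n; exact: seq_mod_ge0.
- by move=> n; rewrite mulr_ge0 ?normR_ge0// seq_mod_ge0.
- move=> n; rewrite -seq_mod_shift /seq_mod -normRM resolvent_solE//.
  rewrite (le_trans (normRD _ _))// !normRM normR_nat normR_real ger0_norm//.
  by rewrite [_ * normR l^-1]mulrC.
- apply: seq_normZ; rewrite ?normR_ge0 ?ell_normRE//.
  by move=> n; exact: seq_mod_ge0.
Qed.

Lemma cesaro_resolvent l : l \notin Lambda0 R -> resolvent_set T l.
Proof.
move=> lL; have l0 : l != 0.
  by apply: contraNneq lL => ->; rewrite inE; right.
have [K K0 HK] := resolvent_sol_bound lL.
pose Z y := ell_mk p1 (HK y); pose S y := l^-1 *: (y + Z y).
have ZE y n : Z y n = resolvent_sol l y n by [].
have Zl : linear Z.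
  by move=> a x y; apply: ell_ext => n; exact: resolvent_sol_linear.
have ZK y : normR (Z y) <= K * normR y by rewrite ell_normR_le HK.
have TS y : T (S y) = Z y.
  apply: cesaro_op_eq => n; rewrite !ellZ !ellD ZE.
  have -> : l^-1 * (y n + resolvent_sol l y n) =
    y n / l + l^-1 * resolvent_sol l y n by ring.
  by rewrite addrA -resolvent_solE// mulrBl subrK.
exists S; split.
- apply: (@bounded_operator_le _ _ _ (normR l^-1 * (1 + K))).
    move=> a x y; rewrite /S Zl addrACA -scalerDr [LHS]scalerDr.
    by rewrite !scalerA (mulrC a).
  move=> y; rewrite normRZ -mulrA ler_wpM2l ?normR_ge0// mulrDl mul1r.
  by rewrite (le_trans (normRD _ _))// lerD2l.
(* [T x] satisfies the recurrence defining [Z y], whose leading coefficients do not vanish, so both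
   agree entry by entry. *)
- move=> x; set y := l *: x - T x.
  suff Zy : Z y = T x by rewrite /S Zy subrK scalerA mulVf// scale1r.
  apply: ell_ext; elim=> [|n IH].
    apply: (mulfI (resolvent_sol_den_neq0 0 lL)).
    rewrite resolvent_solE// /= mul0r mulr0 add0r ellD ellN ellZ.
    have := cesaro_op_rec t0 t1 x 0; rewrite /= mul0r mulr0 add0r => Tx.
    by rewrite [RHS]mulrBl Tx; field.
  apply: (mulfI (resolvent_sol_den_neq0 n.+1 lL)).
  rewrite resolvent_solE// /= -ZE IH ellD ellN ellZ.
  have := cesaro_op_rec t0 t1 x n.+1 => /= Tx.
  by rewrite [RHS]mulrBl Tx; field.
- move=> y; rewrite TS scalerA divff// scale1r addrK//.
Qed.

Lemma cesaro_spectrum : spectrum T = Lambda0 R.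
Proof.
rewrite eqEsubset; split=> l.
  move=> nl; apply: contrapT => lL; apply: nl.
  by apply: cesaro_resolvent; rewrite notin_setE.
case=> [|->].
  rewrite -cesaro_point_spectrum => -[x x0 Tx] [S [[Sl _] S1 _]].
  move/eqP: x0; apply; rewrite -(S1 x) Tx subrr.
  by have := Sl (-1) 0 0; rewrite scaleN1r oppr0 add0r scaleN1r addNr.
(* [C_t] is not bounded below: [C_t e_k] has norm at most [1 / ((1 - t) (k + 1))]. *)
move=> [S [[Sl Sb] S1 _]].
have Sfin : op_norm S \is a fin_num.
  rewrite ge0_fin_numE// op_norm_ge0//.
  by have := Sl (-1) 0 0; rewrite scaleN1r oppr0 add0r scaleN1r addNr.
have le_S k : (1 - t) * k.+1%:R <= fine (op_norm S).
  (* The vector [- b T e_k] lies in the unit ball and a left inverse of [- T] sends it to [b e_k],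
     of norm [b]; letting [k] grow contradicts boundedness. *)
  pose b := (1 - t) * k.+1%:R; pose e := ell_delta p1 k.
  have b0 : 0 < b by rewrite mulr_gt0// subr_gt0.
  have Te : normR (T e) <= b^-1.
    have w : (seq_norm p (fun n => k.+1%:R^-1 * (n.+1%:R * seq_mod (T e) n))%R
        <= (k.+1%:R^-1 * (normR e / (1 - t)))%:E)%E.
      apply: seq_normZ (cesaro_op_weighted t0 t1 e) => //.
      by move=> n; rewrite mulr_ge0// seq_mod_ge0.
    rewrite ell_normR_le invfM mulrC; move: w; rewrite normR_ell_delta mul1r.
    apply: seq_norm_le => // n; rewrite seq_mod_ge0/=.
    have [nk|kn] := ltnP n k.
      suff -> : seq_mod (T e) n = 0 by rewrite !mulr0.
      rewrite /seq_mod cesaro_opE /gen_cesaro big1 ?mul0r ?normR0// => i _.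
      by rewrite ell_deltaE ltn_eqF ?mulr0// (leq_trans (ltn_ord i)).
    rewrite mulrA ler_peMl ?seq_mod_ge0//.
    by rewrite mulrC ler_pdivlMr// mul1r ler_nat ltnS.
  rewrite -lee_fin fineK//.
  have := @op_norm_ge _ _ S (- b%:C *: T e).
  have {2}-> : - b%:C *: T e = 0 *: (b%:C *: e) - T (b%:C *: e).
    by rewrite scale0r sub0r linearZ_LR scaleNr.
  rewrite S1 !normRZ normR_ell_delta mulr1 normRN normR_real gtr0_norm//; apply.
  by rewrite -ler_pdivlMl// mulr1.
pose k := Num.truncn (fine (op_norm S) / (1 - t)).
have := le_S k; rewrite leNgt => /negP; apply.
by rewrite mulrC -ltr_pdivrMr ?subr_gt0// truncnS_gt.
Qed.

End Spectrum.

(** * Mean ergodicity *)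

Section Ergodicity.
Context (R : realType) (t : R) (t0 : 0 <= t) (t1 : t < 1).
Context (p : \bar R) (p1 : (1 <= p)%E).
Implicit Types (x y : ell p1).
Local Notation T := (cesaro_op t0 t1 (p1 := p1)).

Lemma geometric_mem :
  (seq_norm p (seq_mod (fun n => (t ^+ n)%:C)) <= (1 / (1 - t))%:E)%E.
Proof.
apply: (seq_norm_geometric p1 t0 t1 _ _ _ (seq_norm_delta 0 p1)) => //.
  by move=> n; exact: seq_mod_ge0.
case=> [|n] /=; rewrite /seq_mod !normR_real !ger0_norm ?exprn_ge0//.
  by rewrite mulr0 add0r expr0.
by rewrite addr0 exprS.
Qed.

Definition ell_geometric : ell p1 := ell_mk p1 geometric_mem.
Local Notation u := ell_geometric.

Definition fixed_proj x : ell p1 := x 0%N *: u.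
Local Notation P := fixed_proj.

Lemma fixed_proj_linear : linear P.
Proof. by move=> a x y; rewrite /P ellD ellZ scalerDl scalerA. Qed.

Lemma fixed_proj_le x : normR (P x) <= normR u * normR x.
Proof. by rewrite normRZ mulrC ler_wpM2l ?normR_ge0// ell_coord_le. Qed.

Lemma cesaro_fixed_proj x : T (P x) = P x.
Proof.
apply: cesaro_op_eq => -[|n] /=; first by rewrite mul0r mulr0 add0r mul1r.
by rewrite !ellZ !ell_mkE exprS rmorphM/= -[n.+2%:R]natr1; ring.
Qed.

Lemma cesaro_iter_split m x : iter m T x = iter m T (x - P x) + P x.
Proof.
elim: m => [|m IH] /=; first by rewrite subrK.
by rewrite {1}IH linearD/= cesaro_fixed_proj.
Qed.

(** The geometric vector starts with [1] and is fixed by [C_t], so [x - P x] and all its iterates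
    have zeroth entry [0], as the decay estimate requires. *)
Lemma cesaro_iter_decay : exists2 K, 0 <= K &
  forall x m, normR (iter m T x - P x) <= K * (3 / 4) ^+ m * normR x.
Proof.
have [K K0 HK] := cesaro_decay t0 t1.
exists (K * (1 + normR u)).
  by rewrite mulr_ge0 ?addr_ge0 ?normR_ge0.
move=> x m; rewrite cesaro_iter_split addrK; set y : ell p1 := x - P x.
have y0 k : iter k T y 0%N = 0.
  elim: k => [|k IH] /=; first by rewrite ellD ellN ellZ ell_mkE expr0 mulr1 subrr.
  by have := cesaro_op_rec t0 t1 (iter k T y) 0; rewrite mul0r mulr0 add0r mul1r IH.
have yM : normR y <= (1 + normR u) * normR x.
  by rewrite mulrDl mul1r (le_trans (normRB _ _))// lerD2l fixed_proj_le.
apply: (@le_trans _ _ (K * (3 / 4) ^+ m * normR y)); last first.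
  have -> : K * (1 + normR u) * (3 / 4) ^+ m * normR x =
    K * (3 / 4) ^+ m * ((1 + normR u) * normR x) by ring.
  by rewrite ler_wpM2l// mulr_ge0// exprn_ge0.
rewrite ell_normR_le.
apply: (HK p (fun k => seq_mod (iter k T y))) => //.
- by move=> k n; exact: seq_mod_ge0.
- by rewrite /= ell_normRE.
- by move=> k; rewrite /seq_mod y0 normR0.
- by move=> k; exact: cesaro_le_gen_cesaro.
Qed.

Lemma cesaro_power_bounded : power_bounded T.
Proof.
have [K K0 HK] := cesaro_iter_decay.
apply: (@le_lt_trans _ _ (K + normR u)%:E); last by rewrite ltry.
apply: ge_ereal_sup => _ [m _ <-].
apply: op_norm_le => [|x]; first by rewrite addr_ge0 ?normR_ge0.
rewrite -[X in normR X](subrK (P x)) (le_trans (normRD _ _))// mulrDl.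
rewrite lerD ?fixed_proj_le// (le_trans (HK x m))// ler_wpM2r ?normR_ge0//.
by rewrite ler_piMr// exprn_ile1// ler_pdivrMr// mul1r ler_nat.
Qed.

Lemma cesaro_uniformly_mean_ergodic : uniformly_mean_ergodic T.
Proof.
have [K K0 HK] := cesaro_iter_decay.
exists P; first exact: bounded_operator_le fixed_proj_linear fixed_proj_le.
have geo n : \sum_(1 <= m < n.+1) (3 / 4 : R) ^+ m <= 3.
  have -> : \sum_(1 <= m < n.+1) (3 / 4 : R) ^+ m = 3 - 3 * (3 / 4) ^+ n.
    elim: n => [|n IH]; first by rewrite big_geq// expr0; ring.
    by rewrite big_nat_recr//= IH exprS; field.
  by rewrite gerBl mulr_ge0// exprn_ge0.
have meanE n x : ergodic_mean T n.+1 x - P x =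
    n.+1%:R^-1 *: \sum_(1 <= m < n.+2) (iter m T x - P x).
  rewrite /ergodic_mean sumrB scalerBr; congr (_ - _).
  rewrite big_const_nat iter_addr_0 subSS subn0 -[P x *+ _]scaler_nat scalerA.
  by rewrite mulVf ?scale1r// pnatr_eq0.
have le_mean n : (op_norm (fun x => ergodic_mean T n.+1 x - P x)%R <=
    (3 * K * n.+1%:R^-1)%:E)%E.
  apply: op_norm_le => [|x]; first by rewrite !mulr_ge0.
  rewrite meanE normRZ normRV normR_nat [_ * n.+1%:R^-1]mulrC -mulrA.
  rewrite ler_wpM2l// (le_trans (normR_sum _ _ _))//.
  apply: (@le_trans _ _ (\sum_(1 <= m < n.+2) K * (3 / 4) ^+ m * normR x)).
    by apply: ler_sum => m _; exact: HK.
  rewrite -mulr_suml -mulr_sumr ler_wpM2r ?normR_ge0// mulrC.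
  by rewrite ler_wpM2r.
(* [harmonic n] is [1/(n+1)] while the mean of [n] terms yields [1/n]; doubling [3 K] to [6 K] makes
   up for the shift. *)
have op_bounds n : (0 < n)%N ->
    (0 <= op_norm (fun x => ergodic_mean T n x - P x)%R <= (6 * K * harmonic n)%:E)%E.
  case: n => // n _; apply/andP; split.
    apply: op_norm_ge0; rewrite meanE big1 ?scaler0// => m _.
    have -> : iter m T 0 = 0 by elim: m => //= m ->; rewrite linear0.
    by rewrite /P ell0 scale0r subrr.
  apply: (le_trans (le_mean n)); rewrite lee_fin.
  have -> : 6 * K * harmonic n.+1 = 3 * K * (2 / n.+2%:R) by rewrite /harmonic/=; ring.
  rewrite ler_wpM2l ?mulr_ge0// ler_pdivlMr// ler_pdivrMl// mulrC -natrM ler_nat.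
  by rewrite mul2n -addnn addSn addnS !ltnS leq_addr.
apply: (squeeze_cvge (f := fun=> 0%E) (h := fun n => (6 * K * harmonic n)%:E)).
- by near=> n; apply: op_bounds; near: n; exact: nbhs_infty_gt.
- exact: cvg_cst.
- apply/fine_cvgP; split; first by apply: nearW.
  rewrite -(mulr0 (6 * K)); apply: cvgMr.
  exact: cvg_harmonic.
Unshelve. all: by end_near. Qed.

End Ergodicity.

(** * Operator norms *)

Section Hardy.
Context (R : realType) (r : R) (r1 : 1 < r).

Let r0 : 0 < r. Proof. exact: lt_trans r1. Qed.

Lemma young_powR (a b : R) : 0 <= a -> 0 <= b ->
  a `^ (r - 1) * b <= (1 - r^-1) * a `^ r + r^-1 * b `^ r.
Proof.
move=> a0 b0; have r10 : 0 < r - 1 by rewrite subr_gt0.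
have := @conjugate_powR _ (a `^ (r - 1)) b (r / (r - 1)) r (powR_ge0 _ _) b0.
rewrite -powRrM mulrCA divff ?gt_eqF// mulr1.
have -> : a `^ r / (r / (r - 1)) = (1 - r^-1) * a `^ r by field; rewrite !gt_eqF.
rewrite [_ / r]mulrC; apply => //; first by rewrite divr_gt0.
by field; rewrite !gt_eqF.
Qed.

(* Elliott's proof of Hardy's inequality: Young's inequality makes the sum
   telescope. *)
Lemma hardy_sum (a m : nat -> R) N : (forall n, 0 <= a n) -> (forall n, 0 <= m n) ->
  (forall n, n.+1%:R * m n = n%:R * seq_shift m n + a n) ->
  \sum_(n < N) m n `^ r <= (r / (r - 1)) `^ r * \sum_(n < N) a n `^ r.
Proof.
move=> a0 m0 ma; have r10 : 0 < r - 1 by rewrite subr_gt0.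
pose q := r / (r - 1); have q0 : 0 <= q by rewrite divr_ge0 ?ltW.
have s0 := @seq_shift_ge0 _ _ m0.
(* Young's inequality bounds the summand by [(n m_(n-1)^r - (n+1) m_n^r) / (r - 1)]; keeping the
   boundary term on the left makes the induction close. *)
have telescope : \sum_(n < N) (m n `^ r - q * (m n `^ (r - 1) * a n)) +
    N%:R / (r - 1) * seq_shift m N `^ r <= 0.
  elim: N => [|N IH]; first by rewrite big_ord0 mul0r mul0r addr0.
  rewrite big_ord_recr/=; apply: le_trans IH; rewrite -addrA lerD2l.
  have -> : a N = N.+1%:R * m N - N%:R * seq_shift m N.
    by rewrite ma addrC addKr.
  have := young_powR (m0 N) (s0 N); have := mulr_powRB1 (m0 N) r0.
  move: (m N `^ (r - 1)) (m N `^ r) (seq_shift m N `^ r) => B A A' BA y.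
  have -> : B * (N.+1%:R * m N - N%:R * seq_shift m N) =
      N.+1%:R * A - N%:R * (B * seq_shift m N) by rewrite -BA; ring.
  have : 0 <= N%:R * r / (r - 1) * ((1 - r^-1) * A + r^-1 * A' - B * seq_shift m N).
    by rewrite mulr_ge0 ?subr_ge0// divr_ge0 ?mulr_ge0// ltW.
  move: (B * _) => D h; rewrite -subr_ge0.
  apply: (le_trans h); rewrite le_eqVlt; apply/orP; left; apply/eqP.
  by rewrite /q -natr1; field; rewrite !gt_eqF.
(* A second use of Young's inequality, with [q a_n]: the part [(1 - 1/r)] of the sum of [m_n^r] is
   absorbed, which leaves the constant [q^r]. *)
have := ler_sum (index_enum 'I_N) (P := xpredT)
  (fun (n : 'I_N) _ => young_powR (m0 n) (mulr_ge0 q0 (a0 n))).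
have : 0 <= N%:R / (r - 1) * seq_shift m N `^ r.
  by rewrite mulr_ge0 ?powR_ge0// divr_ge0// ltW.
move: telescope; rewrite sumrB big_split/= -!mulr_sumr.
under [X in _ -> _ -> X <= _ -> _]eq_bigr do rewrite mulrCA.
under [X in _ -> _ -> _ <= _ + _ * X -> _]eq_bigr do rewrite powRM//.
rewrite -!mulr_sumr.
move: (\sum_(i < N) m i `^ r) (\sum_(i < N) a i `^ r) => A S.
move: (_ * _ `^ r) (q * _) (q `^ r * S) => X Y Z h1 h2 h3.
have : r^-1 * A <= r^-1 * Z by lra.
by rewrite ler_pM2l ?invr_gt0.
Qed.

End Hardy.

(** * Partial sums of the logarithmic series *)

Section LnSeries.
Context (R : realType).
Implicit Types s t : R.

Lemma is_derive_ln_partial N s :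
  is_derive s 1 (fun x : R => \sum_(j < N) j.+1%:R^-1 * x ^+ j.+1) (\sum_(j < N) s ^+ j).
Proof.
elim: N => [|N IH].
  under eq_fun do rewrite big_ord0.
  by rewrite big_ord0; exact: is_derive_cst.
under eq_fun do rewrite big_ord_recr/=.
rewrite big_ord_recr/=; apply: is_deriveD.
have -> : (fun x : R => N.+1%:R^-1 * x ^+ N.+1) = N.+1%:R^-1 \*: (@idfun R ^+ N.+1).
  by apply/funext => x /=; rewrite exprfctE.
apply: (is_derive_eq (is_deriveZ _ (is_deriveX _ (is_derive_id _ _)))).
by rewrite /GRing.scale/= mulr1 mulKf ?pnatr_eq0.
Qed.

(** The remainder [f] vanishes at [0] and has derivative [s^N / (1 - s)], nonnegative and increasing
    on [[0, t]], so the mean value theorem gives both bounds. *)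
Lemma ln_partial_sum_bound t N : 0 <= t -> t < 1 ->
  0 <= ln (1 / (1 - t)) - \sum_(j < N) j.+1%:R^-1 * t ^+ j.+1 <= t ^+ N / (1 - t) * t.
Proof.
move=> t0 t1.
pose f s := - ln (1 - s) - \sum_(j < N) j.+1%:R^-1 * s ^+ j.+1.
pose df s := s ^+ N / (1 - s).
have fdf s : s < 1 -> is_derive s 1 f (df s).
  move=> s1; have s10 : 0 < 1 - s by rewrite subr_gt0.
  have dln : is_derive s 1 (fun x : R => ln (1 - x)) (- (1 - s)^-1).
    have d1 : is_derive s 1 (fun x : R => 1 - x) (0 - 1).
      by apply: is_deriveB.
    have dl : is_derive (1 - s) 1 (@ln R) (1 - s)^-1 by exact: is_derive1_ln.
    have := @is_derive1_comp R (@ln R) (fun x => 1 - x) s _ _ dl d1.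
    by rewrite sub0r mulrN1.
  have dp := is_derive_ln_partial N s.
  apply: (is_derive_eq (is_deriveB (is_deriveN dln) dp)).
  rewrite opprK /df; apply: (@mulIf _ (1 - s)); first by rewrite gt_eqF.
  rewrite mulrBl !mulVf ?mulfVK ?gt_eqF//.
  have := subrX1 s N; lra.
have [||c] := @MVT_segment R f df 0 t t0.
- by move=> s; rewrite in_itv/= => /andP[_ st]; apply: fdf; exact: lt_trans t1.
- apply: derivable_within_continuous => s; rewrite in_itv/= => /andP[_ st].
  by have [] := fdf s (le_lt_trans st t1).
rewrite in_itv/= => /andP[c0 ct].
have -> : f 0 = 0.
  rewrite /f subr0 ln1 big1 ?subrr ?oppr0 ?addr0// => j _.
  by rewrite expr0n mulr0.
rewrite !subr0 div1r lnV ?posrE ?subr_gt0// -/(f t) => ->.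
have c1 : 0 < 1 - c by rewrite subr_gt0 (le_lt_trans ct).
rewrite /df !mulr_ge0 ?exprn_ge0 ?invr_ge0 ?(ltW c1)//=.
rewrite ler_wpM2r// ler_pM ?exprn_ge0 ?invr_ge0 ?(ltW c1)//.
  by rewrite lerXn2r// nnegrE.
by rewrite lef_pV2 ?posrE ?subr_gt0 ?(le_lt_trans ct)// lerD2l lerN2.
Qed.

Lemma ln_partial_sum_le t N : 0 < t -> t < 1 ->
  \sum_(j < N) j.+1%:R^-1 * t ^+ j <= t^-1 * ln (1 / (1 - t)).
Proof.
move=> t0 t1; rewrite ler_pdivlMl// mulr_sumr -subr_ge0.
have /andP[h _] := ln_partial_sum_bound N (ltW t0) t1.
by under eq_bigr do rewrite mulrCA -exprS.
Qed.

Lemma ln_partial_sum_sup t (M : R) : 0 < t -> t < 1 ->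
  (forall N, \sum_(j < N) j.+1%:R^-1 * t ^+ j <= M) ->
  t^-1 * ln (1 / (1 - t)) <= M.
Proof.
move=> t0 t1 HM; rewrite ler_pdivrMl// -subr_le0.
set L := ln _.
have t'0 : 0 < 1 - t by rewrite subr_gt0.
have bnd N : L - t * M <= t / (1 - t) * t ^+ N.
  have S : \sum_(j < N) j.+1%:R^-1 * t ^+ j.+1 <= t * M.
    apply: le_trans (ler_wpM2l (ltW t0) (HM N)); rewrite mulr_sumr.
    by under [leRHS]eq_bigr do rewrite mulrCA -exprS.
  have -> : t / (1 - t) * t ^+ N = t ^+ N / (1 - t) * t by ring.
  have /andP[_ /(le_trans _)] := ln_partial_sum_bound N (ltW t0) t1; apply.
  by rewrite -/L lerD2l lerN2.
have cv : t / (1 - t) * t ^+ N @[N --> \oo] --> (0 : R).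
  rewrite -(mulr0 (t / (1 - t))); apply: cvgMr; apply: cvg_expr.
  by rewrite ger0_norm ?ltW.
rewrite -(cvg_lim _ cv)//; apply: limr_ge; first by apply/cvg_ex; exists 0.
exact: nearW.
Qed.

End LnSeries.

(** * Norms of the operator for each exponent *)

Section CesaroNorms.
Context (R : realType) (t : R) (t0 : 0 <= t) (t1 : t < 1).
Implicit Types (u : nat -> R[i]).

Lemma ell_op_norm_le (p : \bar R) (p1 : (1 <= p)%E) (T : ell p1 -> ell p1) (K : R) :
  0 <= K ->
  (forall x : ell p1, (seq_norm p (seq_mod (T x)) <= (K * normR x)%:E)%E) ->
  (op_norm T <= K%:E)%E.
Proof. by move=> K0 TK; apply: op_norm_le => // x; rewrite ell_normR_le. Qed.

(** The classical case [t = 1]. It dominates [C_t] on moduli, whence bounds independent of [t] for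
    [p > 1]. *)
Definition seq_average (f : nat -> R) n : R := (\sum_(i < n.+1) f i) / n.+1%:R.

Lemma seq_mod_gen_cesaro_le u n :
  seq_mod (gen_cesaro t u) n <=
  (\sum_(i < n.+1) t ^+ (n - i) * seq_mod u i) / n.+1%:R.
Proof.
rewrite /seq_mod /gen_cesaro normRM normRV normR_nat ler_wpM2r ?invr_ge0//.
rewrite (le_trans (normR_sum _ _ _))//; apply: ler_sum => i _.
by rewrite normRM normR_real ger0_norm ?exprn_ge0.
Qed.

Lemma seq_mod_gen_cesaro_le_average u n :
  seq_mod (gen_cesaro t u) n <= seq_average (seq_mod u) n.
Proof.
apply: (le_trans (seq_mod_gen_cesaro_le u n)).
rewrite ler_wpM2r ?invr_ge0//; apply: ler_sum => i _.
by rewrite ler_piMl ?seq_mod_ge0// exprn_ile1// ltW.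
Qed.

Lemma op_norm_cesaro_ge1 (p : \bar R) (p1 : (1 <= p)%E) :
  (1 <= op_norm (cesaro_op t0 t1 (p1 := p1)))%E.
Proof.
pose e := ell_delta p1 0.
apply: (@le_trans _ _ (normR (cesaro_op t0 t1 e))%:E).
  rewrite lee_fin (le_trans _ (ell_coord_le _ 0))//.
  have := cesaro_op_rec t0 t1 e 0; rewrite mul0r mulr0 add0r mul1r => ->.
  by rewrite ell_deltaE normR1.
by apply: op_norm_ge; rewrite normR_ell_delta.
Qed.

Lemma op_norm_cesaro_infty (p1 : (1 <= +oo)%E) :
  op_norm (cesaro_op t0 t1 (p1 := p1)) = 1%E.
Proof.
apply/eqP; rewrite eq_le op_norm_cesaro_ge1 andbT.
apply: ell_op_norm_le => // x; rewrite mul1r.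
apply/seq_norm_inftyP => [n|n]; first exact: seq_mod_ge0.
rewrite lee_fin (le_trans (seq_mod_gen_cesaro_le_average _ n))//.
have : \sum_(i < n.+1) seq_mod x i <= \sum_(i < n.+1) normR x.
  by apply: ler_sum => i _; exact: ell_coord_le.
by rewrite sumr_const card_ord -mulr_natr ler_pdivrMr.
Qed.

Lemma op_norm_cesaro_hardy (p : R) (p1 : (1 <= p%:E)%E) : 1 < p ->
  (op_norm (cesaro_op t0 t1 (p1 := p1)) <= (p / (p - 1))%:E)%E.
Proof.
move=> lt1p; have p0 : 0 < p by exact: lt_trans lt1p.
have q0 : 0 <= p / (p - 1) by rewrite divr_ge0 ?subr_ge0 ?ltW.
apply: ell_op_norm_le => // x.
have a0 n : 0 <= seq_average (seq_mod x) n.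
  by rewrite divr_ge0// sumr_ge0// => i _; exact: seq_mod_ge0.
apply: (seq_norm_le p1 (f := seq_average (seq_mod x))) => [n|].
  by rewrite seq_mod_ge0 seq_mod_gen_cesaro_le_average.
apply/(seq_normP p0) => //; first by rewrite mulr_ge0 ?normR_ge0.
move=> N; rewrite powRM ?normR_ge0//.
apply: (le_trans (hardy_sum lt1p N (seq_mod_ge0 x) a0 _)).
  case=> [|n]; rewrite /seq_average [LHS]mulrC mulfVK ?pnatr_eq0//.
    by rewrite big_ord_recl big_ord0 mul0r add0r addr0.
  by rewrite big_ord_recr/= [_ * (_ / _)]mulrC mulfVK ?pnatr_eq0.
rewrite ler_wpM2l ?powR_ge0//.
by move: N; apply/(seq_normP p0 (normR_ge0 _) (seq_mod_ge0 x)); rewrite ell_normRE.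
Qed.

Lemma ell1_normR_le (p1 : (1 <= 1 :> \bar R)%E) (x : ell p1) M : 0 <= M ->
  normR x <= M <-> forall N, \sum_(n < N) seq_mod x n <= M.
Proof.
move=> M0; rewrite ell_normR_le.
have sumE N : \sum_(n < N) seq_mod x n `^ 1 = \sum_(n < N) seq_mod x n.
  by apply: eq_bigr => i _; rewrite powRr1// seq_mod_ge0.
split=> [/(seq_normP ltr01 M0 (seq_mod_ge0 x)) h N|h].
  by have := h N; rewrite sumE powRr1.
by apply/(seq_normP ltr01 M0 (seq_mod_ge0 x)) => N; rewrite sumE powRr1.
Qed.

(* The columns of [C_t] have decreasing [l^1] norms. *)
Lemma op_norm_cesaro1_le (p1 : (1 <= 1 :> \bar R)%E) M : 0 <= M ->
  (forall N, \sum_(j < N) j.+1%:R^-1 * t ^+ j <= M) ->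
  (op_norm (cesaro_op t0 t1 (p1 := p1)) <= M%:E)%E.
Proof.
move=> M0 HM; apply: ell_op_norm_le => // x; rewrite -ell_normR_le.
apply/ell1_normR_le; first by rewrite mulr_ge0 ?normR_ge0.
move=> N.
apply: (@le_trans _ _ (\sum_(n < N) \sum_(i < N | (i <= n)%N)
    n.+1%:R^-1 * (t ^+ (n - i) * seq_mod x i))).
  apply: ler_sum => n _; apply: (le_trans (seq_mod_gen_cesaro_le x n)).
  rewrite mulrC mulr_sumr.
  rewrite (big_ord_widen N (fun i => n.+1%:R^-1 * (t ^+ (n - i) * seq_mod x i)))//.
rewrite (exchange_big_dep xpredT)//=.
apply: (@le_trans _ _ (\sum_(i < N) M * seq_mod x i)).
  apply: ler_sum => i _.
  under eq_bigr do rewrite mulrA.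
  rewrite -mulr_suml ler_wpM2r ?seq_mod_ge0//.
  apply: le_trans (HM N).
  rewrite -(big_geq_mkord _ _ xpredT (fun n => n.+1%:R^-1 * t ^+ (n - i))).
  (* With [j = n - i], the entries of column [i] become [t^j / (j + i + 1)], at most the entries
     [t^j / (j + 1)] of column [0]. *)
  rewrite -{1}[nat_of_ord i]add0n big_addn big_mkord.
  rewrite (big_ord_widen N (fun n => (n + i).+1%:R^-1 * t ^+ (n + i - i)) (leq_subr i N)).
  rewrite [leRHS](bigID (fun j : 'I_N => (j < N - i)%N))/=.
  rewrite -[leLHS]addr0 lerD//.
    apply: ler_sum => j _; rewrite addnK ler_wpM2r ?exprn_ge0//.
    by rewrite lef_pV2 ?posrE// ler_nat ltnS leq_addr.
  by rewrite sumr_ge0// => j _; rewrite mulr_ge0 ?exprn_ge0.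
rewrite -mulr_sumr ler_wpM2l//.
by move: N; apply/ell1_normR_le; rewrite ?normR_ge0.
Qed.

(** These are the partial sums of the norm of [C_t e_0], the largest column, at which the [l^1] norm
    of the operator is attained. *)
Lemma op_norm_cesaro1_ge (p1 : (1 <= 1 :> \bar R)%E) N :
  ((\sum_(j < N) j.+1%:R^-1 * t ^+ j)%:E <= op_norm (cesaro_op t0 t1 (p1 := p1)))%E.
Proof.
pose e := ell_delta p1 0.
apply: (@le_trans _ _ (normR (cesaro_op t0 t1 e))%:E); last first.
  by apply: op_norm_ge; rewrite normR_ell_delta.
rewrite lee_fin.
have /(ell1_normR_le _ (normR_ge0 _))/(_ N) := lexx (normR (cesaro_op t0 t1 e)).
apply: le_trans; apply: ler_sum => j _.
rewrite /seq_mod cesaro_opE /gen_cesaro big_ord_recl/= big1 => [|i _]; last first.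
  by rewrite ell_deltaE /= mulr0.
rewrite ell_deltaE mulr1 addr0 subn0 normRM normRV normR_nat normR_real.
by rewrite ger0_norm ?exprn_ge0// mulrC.
Qed.

Lemma op_norm_cesaro1 (p1 : (1 <= 1 :> \bar R)%E) : 0 < t ->
  op_norm (cesaro_op t0 t1 (p1 := p1)) = (t^-1 * ln (1 / (1 - t)))%:E.
Proof.
move=> t_gt0; apply/eqP; rewrite eq_le; apply/andP; split.
  apply: op_norm_cesaro1_le => [|N]; last exact: ln_partial_sum_le.
  by have := ln_partial_sum_le 0 t_gt0 t1; rewrite big_ord0.
have [fin|] := boolP (op_norm (cesaro_op t0 t1 (p1 := p1)) \is a fin_num); last first.
  have h : (0 <= op_norm (cesaro_op t0 t1 (p1 := p1)))%E.
    exact: le_trans lee01 (op_norm_cesaro_ge1 p1).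
  by rewrite ge0_fin_numE// -leNgt leye_eq => /eqP ->; rewrite leey.
rewrite -(fineK fin) lee_fin; apply: ln_partial_sum_sup => // N.
by rewrite -lee_fin fineK//; exact: op_norm_cesaro1_ge.
Qed.

Lemma op_norm_cesaro1_0 (p1 : (1 <= 1 :> \bar R)%E) : t = 0 ->
  op_norm (cesaro_op t0 t1 (p1 := p1)) = 1%E.
Proof.
move=> t00; apply/eqP; rewrite eq_le op_norm_cesaro_ge1 andbT.
apply: op_norm_cesaro1_le => // -[|N]; first by rewrite big_ord0.
rewrite big_ord_recl/= invr1 mul1r expr0 big1 ?addr0// => i _.
by rewrite t00 expr0n mulr0.
Qed.

End CesaroNorms.

Local Close Scope complex_scope.

Theorem proposition4p2 (R : realType) (t : R) (t0 : 0 <= t) (t1 : t < 1) :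
  exists C : forall (p : \bar R) (p1 : (1 <= p)%E), ell p1 -> ell p1,
    (forall (p : \bar R) (p1 : (1 <= p)%E),
        (forall (x : ell p1) (n : nat), C p p1 x n = gen_cesaro t x n) /\
        bounded_operator (C p p1)) /\
    (let C1 := C 1%E (lexx 1%E) in
        (0 < t -> op_norm C1 = (t^-1 * ln (1 / (1 - t)))%:E) /\
        (t = 0 -> op_norm C1 = 1%E) /\
        compact_operator C1 /\
        point_spectrum C1 = Lambda R /\
        spectrum C1 = Lambda0 R /\
        power_bounded C1 /\
        uniformly_mean_ergodic C1 /\
        ~ supercyclic C1) /\
    (let Coo := C +oo%E (leey 1%E) in
        op_norm Coo = 1%E /\
        compact_operator Coo /\
        point_spectrum Coo = Lambda R /\
        spectrum Coo = Lambda0 R /\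
        power_bounded Coo /\
        uniformly_mean_ergodic Coo /\
        ~ supercyclic Coo) /\
    (forall (p : R) (p1 : (1 < p%:E)%E),
        let Cp := C p%:E (ltW p1) in
        (op_norm Cp <= (p / (p - 1))%:E)%E /\
        compact_operator Cp /\
        point_spectrum Cp = Lambda R /\
        spectrum Cp = Lambda0 R /\
        power_bounded Cp /\
        uniformly_mean_ergodic Cp /\
        ~ supercyclic Cp).
Proof.
exists (fun p p1 => cesaro_op t0 t1 (p1 := p1)).
have common (p : \bar R) (p1 : (1 <= p)%E) (T := cesaro_op t0 t1 (p1 := p1)) :
    compact_operator T /\ point_spectrum T = Lambda R /\ spectrum T = Lambda0 R /\
    power_bounded T /\ uniformly_mean_ergodic T /\ ~ supercyclic T.
  do 5 (split; first by [exact: cesaro_op_compact|exact: cesaro_point_spectrum|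
    exact: cesaro_spectrum|exact: cesaro_power_bounded|
    exact: cesaro_uniformly_mean_ergodic]).
  exact: cesaro_op_not_supercyclic.
split=> [p p1|]; first by split=> [//|]; exact: cesaro_op_bounded.
split; first split; first exact: op_norm_cesaro1.
  by split; [exact: op_norm_cesaro1_0|exact: common].
split; first by split; [exact: op_norm_cesaro_infty|exact: common].
move=> p p1; split; last exact: common.
by apply: op_norm_cesaro_hardy; rewrite -lte_fin.
Qed.
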